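(* Let $n \geq 2$, let $D \subset \mathbb{C}^n$ be a non-degenerate convex domain, and let $z \in D$. Then $$\frac{1}{(4n)^n} \leq v_D(z)\, p_D^2(z) \leq \left(\frac{4^n-1}{3}\right)^n$$ both for $v_D = c_D$ (the Carathéodory-Eisenman volume element) and for $v_D = k_D$ (the Kobayashi-Eisenman volume element).
   Context: A domain is a nonempty connected open set. A domain $D\subset\mathbb{C}^n$ is non-degenerate if it contains no complex lines (complex affine lines). $\mathbb{B}^n$ is the open unit ball of $\mathbb{C}^n$, $\mathcal{O}(X,Y)$ is the set of holomorphic maps from $X$ to $Y$, and $\det\psi'$ is the complex Jacobian determinant of a holomorphic map $\psi$. The Carathéodory and Kobayashi-Eisenman volume elements of a domain $D\subset \mathbb{C}^n$ at $z^0\in D$ are $$c_D(z^0)=\sup\{|\det\psi'(z^0)|^2:\psi\in\mathcal{O}(D,\mathbb{B}^n),\ \psi(z^0)=0\},$$ $$k_D(z^0)=\inf\{|\det\psi'(0)|^{-2}:\psi\in\mathcal{O}(\mathbb{B}^n,D),\ \psi(0)=z^0\}$$ (with $|\det\psi'(0)|^{-2}=+\infty$ if $\det\psi'(0)=0$). The number $p_D(z^0)$: let $D$ be non-degenerate and $z^0\in D$. Put $H_0=\mathbb{C}^n$. Let $\tau_{1,D}(z^0)$ be the minimum (Euclidean) distance from $z^0$ to $\partial D$ and let $p^1\in\partial D$ be a point realising it. Let $H_1$ be the complex hyperplane through $z^0$ orthogonal (for the standard Hermitian inner product) to $p^1-z^0$. Inductively, for $j=2,\ldots,n$, let $\tau_{j,D}(z^0)$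 be the minimum distance from $z^0$ to $\partial D\cap H_{j-1}$, let $p^j\in\partial D\cap H_{j-1}$ be a point realising it, and (for $j<n$) let $H_j$ be the complex affine subspace of $H_{j-1}$ of codimension one in $H_{j-1}$ that passes through $z^0$ and is orthogonal to $p^j-z^0$. All $\tau_{j,D}(z^0)=\|p^j-z^0\|$ are finite because $D$ is non-degenerate. Then $p_D(z^0):=\tau_{1,D}(z^0)\cdots\tau_{n,D}(z^0)$. The points $p^j$ need not be unique; $p_D(z^0)$ is formed from any such choice, and the claim is for an arbitrary choice. $p_D^2(z)$ means $(p_D(z))^2$. *)

(* Defs.v *)
From HB Require Import structures.
From mathcomp Require Import all_boot all_order all_algebra.
From mathcomp Require Import complex.
From mathcomp Require Import all_classical all_reals all_analysis.

Set Implicit Arguments.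
Unset Strict Implicit.
Unset Printing Implicit Defensive.

Import Order.TTheory GRing.Theory Num.Theory numFieldNormedType.Exports.

Local Open Scope classical_set_scope.
Local Open Scope ring_scope.

(* The cast to numFieldType gives the coefficient field its topology; without
   it the topology of R[i], hence that of C^n, is not found. *)
Notation "''CV[' R ]_ n" := 'rV[((complex R) : numFieldType)]_n
  (at level 8, n at level 2, format "''CV[' R ]_ n") : type_scope.

Definition modC (R : realType) (x : R[i]) : R := ComplexField.Normc.normc x.

Definition enorm (R : realType) (n : nat) (v : 'CV[R]_n) : R :=
  Num.sqrt (\sum_(i < n) modC (v 0 i) ^+ 2).

Definition unit_ball (R : realType) (n : nat) : set 'CV[R]_n :=
  [set w | enorm w < 1].

Definition is_domain (R : realType) (n : nat) (D : set 'CV[R]_n) : Prop :=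
  [/\ D !=set0, open D & connected D].

(* The weights in convex_set range over the x : R[i] with 0 <= x <= 1, and in
   R[i] these are the real numbers of [0, 1]: this is real convexity. *)
Definition is_convex (R : realType) (n : nat) (D : set 'CV[R]_n) : Prop :=
  convex_set D.

Definition complex_line (R : realType) (n : nat) (a b : 'CV[R]_n) :
  set 'CV[R]_n := [set a + t *: b | t in [set: R[i]]].

Definition non_degenerate (R : realType) (n : nat) (D : set 'CV[R]_n) : Prop :=
  forall a b : 'CV[R]_n, b != 0 -> ~ (complex_line a b `<=` D).

Definition bdry (R : realType) (n : nat) (D : set 'CV[R]_n) : set 'CV[R]_n :=
  closure D `\` interior D.

(* O(X, Y) for X open: maps are total functions whose values outside X are
   irrelevant, and differentiable is Frechet differentiability over R[i]. *)
Definition holo (R : realType) (n m : nat) (X : set 'CV[R]_n)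
    (Y : set 'CV[R]_m) : set ('CV[R]_n -> 'CV[R]_m) :=
  [set f | (forall x, X x -> differentiable f x) /\
           (forall x, X x -> Y (f x))].

Definition jac_mod (R : realType) (n : nat) (f : 'CV[R]_n -> 'CV[R]_n)
  (x : 'CV[R]_n) : R := modC (\det (jacobian f x)).

Definition caratheodory_vol (R : realType) (n : nat) (D : set 'CV[R]_n)
    (z : 'CV[R]_n) : \bar R :=
  ereal_sup [set (jac_mod psi z ^+ 2)%:E |
    psi in [set psi | holo D (@unit_ball R n) psi /\ psi z = 0]].

Definition kobayashi_vol (R : realType) (n : nat) (D : set 'CV[R]_n)
    (z : 'CV[R]_n) : \bar R :=
  ereal_inf [set (if jac_mod psi 0 == 0 then +oo%E
                  else (jac_mod psi 0 ^- 2)%:E) |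
    psi in [set psi | holo (@unit_ball R n) D psi /\ psi 0 = z]].

(* p j is the point p^j for 1 <= j <= n; the other values of p are not used. *)
Fixpoint orth_flag (R : realType) (n : nat) (z : 'CV[R]_n)
    (p : nat -> 'CV[R]_n) (j : nat) : set 'CV[R]_n :=
  match j with
  | 0%N => setT
  | j'.+1 => [set w | orth_flag z p j' w /\ dotmx (w - z) (p j - z) = 0]
  end.

Definition minimal_points (R : realType) (n : nat) (D : set 'CV[R]_n)
    (z : 'CV[R]_n) (p : nat -> 'CV[R]_n) : Prop :=
  forall j : nat, (1 <= j <= n)%N ->
    (bdry D `&` orth_flag z p j.-1) (p j) /\
    (forall q, (bdry D `&` orth_flag z p j.-1) q ->
       enorm (p j - z) <= enorm (q - z)).

Definition tau_prod (R : realType) (n : nat) (z : 'CV[R]_n)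
    (p : nat -> 'CV[R]_n) : R :=
  \prod_(1 <= j < n.+1) enorm (p j - z).

(* Main.v *)
(* Put P for the matrix with rows p^j - z.  These rows are orthogonal, so that
   |det P| = p_D(z).

   D contains the discs {z + t (p^j - z) : |t| < 1}, hence the absolutely convex
   hull of them, and the linear map w |-> z + w P / sqrt n sends the unit ball
   into D: this bounds k_D from above.  For a competitor phi of c_D, the Schwarz
   lemma on these discs bounds all the entries of P phi'(z) by 1.

   Conversely, a real supporting functional of D at p^j has a complexification
   L_j that vanishes on the directions of H_{j-1} orthogonal to p^j - z, because
   D contains the ball of radius tau_j of H_{j-1}.  Hence the matrix (L_j (p^i - z))
   is triangular.  Since Re L_j < 1 on D - z when L_j (p^j - z) = 1, the map
   (L_j / (2 - L_j))_j / sqrt n is a competitor for c_D, and the Schwarz lemma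
   applied to L_j / (2 - L_j) composed with a competitor psi of k_D bounds the
   l^1 norms of the columns of psi'(0) L by 2 sqrt n. *)

Require Import Defs.
From HB Require Import structures.
From mathcomp Require Import all_boot all_order all_algebra.
From mathcomp Require Import fingroup perm complex.
From mathcomp Require Import all_classical all_reals all_analysis.
From mathcomp Require Import ring lra zify.
Set Implicit Arguments.
Unset Strict Implicit.
Unset Printing Implicit Defensive.

Import Order.TTheory GRing.Theory Num.Theory numFieldNormedType.Exports.
Local Open Scope classical_set_scope.
Local Open Scope ring_scope.

Local Notation Cx R := ((complex R) : numFieldType).

(** * Goursat's lemma for rectangles *)

(** Quadrisection: [G x y u v] is an additive function of the rectangle [x, y] x [u, v], so one of
    its four quarters always carries at least a quarter of [|G|]. The nested quarters shrink to a
    point, where the local bound, quadratic in the size, contradicts a decay no faster than 4^-n. *)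
Lemma bisection_null (R : realType) (G : R -> R -> R -> R -> R) (a b c d : R) :
  a < b -> c < d ->
  (forall x m y u v, G x y u v = G x m u v + G m y u v) ->
  (forall x y u m v, G x y u v = G x y u m + G x y m v) ->
  (forall s t, a <= s <= b -> c <= t <= d -> forall e, 0 < e ->
    exists2 r, 0 < r & forall x y u v, a <= x -> x <= s <= y -> y <= b ->
      c <= u -> u <= t <= v -> v <= d -> y - x < r -> v - u < r ->
      `|G x y u v| <= e * ((y - x) + (v - u)) ^+ 2) ->
  G a b c d = 0.
Proof.
move=> ab cd Gx Gt Gloc; apply/eqP/negPn/negP => G0.
set g := `|G a b c d|; have g0 : 0 < g by rewrite normr_gt0.
pose l n : R := (b - a) / 2 ^+ n; pose h n : R := (d - c) / 2 ^+ n.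
have p2 n : 0 < 2 ^+ n :> R by rewrite exprn_gt0.
have lS n : l n = l n.+1 + l n.+1.
  by rewrite /l exprS; have := p2 n; move: (2 ^+ n) => q q0; field; lra.
have hS n : h n = h n.+1 + h n.+1.
  by rewrite /h exprS; have := p2 n; move: (2 ^+ n) => q q0; field; lra.
have l0 n : 0 < l n by rewrite divr_gt0 ?subr_gt0.
have h0 n : 0 < h n by rewrite divr_gt0 ?subr_gt0.
pose Q n (q : R * R) := G q.1 (q.1 + l n) q.2 (q.2 + h n).
(* A rectangle is recorded by its lower left corner. [ok] says that the half-size rectangle at [q']
   lies inside the one at [q] and keeps at least a quarter of the value. *)
pose ok n (q q' : R * R) := [/\ q.1 <= q'.1 <= q.1 + l n.+1,
   q.2 <= q'.2 <= q.2 + h n.+1 & `|Q n q| <= 4 * `|Q n.+1 q'| ].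
have stepP n q : exists q', ok n q q'.
  case: q => x y; apply: contrapT => /forallNP H.
  have K x' y' : x <= x' <= x + l n.+1 -> y <= y' <= y + h n.+1 ->
      4 * `|Q n.+1 (x', y')| < `|Q n (x, y)|.
    by move=> Hx Hy; rewrite ltNge; apply/negP => Hq; exact: (H (x', y')).
  have L := l0 n.+1; have M := h0 n.+1.
  have K1 := K x y ltac:(lra) ltac:(lra).
  have K2 := K (x + l n.+1) y ltac:(lra) ltac:(lra).
  have K3 := K x (y + h n.+1) ltac:(lra) ltac:(lra).
  have K4 := K (x + l n.+1) (y + h n.+1) ltac:(lra) ltac:(lra).
  have E : Q n (x, y) = Q n.+1 (x, y) + Q n.+1 (x + l n.+1, y) +
     (Q n.+1 (x, y + h n.+1) + Q n.+1 (x + l n.+1, y + h n.+1)).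
    rewrite /Q /= -!addrA -lS -hS.
    rewrite (Gt x _ y (y + h n.+1)) (Gx x (x + l n.+1) (x + l n) y).
    by rewrite (Gx x (x + l n.+1) (x + l n) (y + h n.+1)) -!addrA.
  have T := ler_normD (Q n.+1 (x, y) + Q n.+1 (x + l n.+1, y))
    (Q n.+1 (x, y + h n.+1) + Q n.+1 (x + l n.+1, y + h n.+1)).
  have T1 := ler_normD (Q n.+1 (x, y)) (Q n.+1 (x + l n.+1, y)).
  have T2 := ler_normD (Q n.+1 (x, y + h n.+1)) (Q n.+1 (x + l n.+1, y + h n.+1)).
  by rewrite -E in T; lra.
pose w := fix w n := if n is k.+1 then xget (0, 0) (ok k (w k)) else (a, c).
have wP n : ok n (w n) (w n.+1).
  by case: (stepP n (w n)) => q oq; exact: (xgetI _ oq).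
have wg n : g <= 4 ^+ n * `|Q n (w n)|.
  elim: n => [|n IH].
    by rewrite /Q /= /l /h !expr0 !divr1 mul1r !(addrC _ (_ - _)) !subrK.
  have [_ _ H] := wP n; apply: (le_trans IH).
  by rewrite exprSr -mulrA ler_pM2l// exprn_gt0.
have wi n : a <= (w n).1 /\ (w n).1 + l n <= b /\ c <= (w n).2 /\ (w n).2 + h n <= d.
  elim: n => [|n [I1 [I2 [I3 I4]]]]; first by rewrite /= /l /h !expr0 !divr1; lra.
  by have [+ + _] := wP n; have := lS n; have := hS n; lra.
have mon n k : (w n).1 <= (w (n + k)%N).1 <= (w n).1 + l n - l (n + k)%N /\
   (w n).2 <= (w (n + k)%N).2 <= (w n).2 + h n - h (n + k)%N.
  elim: k => [|k IH]; first by rewrite addn0; lra.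
  rewrite addnS; have [+ + _] := wP (n + k)%N.
  by have := lS (n + k)%N; have := hS (n + k)%N; lra.
have cmp n k : (w n).1 <= (w k).1 + l k /\ (w n).2 <= (w k).2 + h k.
  have L := l0 n; have M := h0 n; have L' := l0 k; have M' := h0 k.
  case: (leqP n k) => [|/ltnW] /subnKC <-; last first.
    have := mon k (n - k)%N; have := l0 (k + (n - k))%N; have := h0 (k + (n - k))%N.
    by lra.
  by have := mon n (k - n)%N; have := l0 (n + (k - n))%N; have := h0 (n + (k - n))%N; lra.
(* By [cmp] no lower left corner exceeds any upper right corner, in either coordinate, so the two
   suprema give a point common to all the rectangles. *)
pose s := sup (range (fun n => (w n).1)); pose t := sup (range (fun n => (w n).2)).
have sP n : (w n).1 <= s <= (w n).1 + l n.
  apply/andP; split.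
    apply: ub_le_sup; last by exists n.
    by exists ((w 0).1 + l 0) => _ [k _ <-]; have [] := cmp k 0%N.
  apply: ge_sup; first by exists (w 0).1; exists 0%N.
  by move=> _ [k _ <-]; have [] := cmp k n.
have tP n : (w n).2 <= t <= (w n).2 + h n.
  apply/andP; split.
    apply: ub_le_sup; last by exists n.
    by exists ((w 0).2 + h 0) => _ [k _ <-]; have [] := cmp k 0%N.
  apply: ge_sup; first by exists (w 0).2; exists 0%N.
  by move=> _ [k _ <-]; have [] := cmp k n.
have sab : a <= s <= b by have := sP 0; have := wi 0; lra.
have tcd : c <= t <= d by have := tP 0; have := wi 0; lra.
pose z := (b - a) + (d - c); have z0 : 0 < z by rewrite /z; lra.
(* With this tolerance the local bound at stage [n], multiplied by 4^n, is g / 2 whatever [n] is,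
   against the lower bound g of [wg]. *)
have e0 : 0 < g / (2 * z ^+ 2) by rewrite divr_gt0// mulr_gt0// exprn_gt0.
have [r r0 Hr] := Gloc s t sab tcd _ e0.
pose n := Num.Def.archi_bound (z / r).
have zn : z / 2 ^+ n < r.
  have := @upper_nthrootP R (z / r) n (leqnn _).
  by rewrite ltr_pdivrMr// ltr_pdivrMr// mulrC.
have lhz : l n + h n = z / 2 ^+ n by rewrite /l /h /z [RHS]mulrDl.
have L := l0 n; have M := h0 n.
have [I1 [I2 [I3 I4]]] := wi n.
have := Hr (w n).1 ((w n).1 + l n) (w n).2 ((w n).2 + h n) I1 (sP n) I2 I3 (tP n) I4.
have AK (x y : R) : x + y - x = y by rewrite addrAC subrr add0r.
rewrite !AK => /(_ ltac:(lra) ltac:(lra)).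
rewrite lhz -[G _ _ _ _]/(Q n (w n)) => Hq.
have p4 : 0 < 4 ^+ n :> R by rewrite exprn_gt0.
have E : 4 ^+ n * (g / (2 * z ^+ 2) * (z / 2 ^+ n) ^+ 2) = g / 2.
  have -> : 4 ^+ n = (2 ^+ n) ^+ 2 :> R by rewrite -exprM mulnC exprM; congr (_ ^+ n); ring.
  have := p2 n; have := z0; clearbody g z; move: (2 ^+ n) => q; clear => z0 q0; field.
  by rewrite !gt_eqF.
have := le_trans (wg n) (ler_wpM2l (ltW p4) Hq); rewrite E.
by move: g0; clearbody g; clear=> *; lra.
Qed.

(** It replaces the estimate of the integral of [df] over [x, y]: the increment of the
    antiderivative [f] is compared with that of a linear function of slope [k]. *)
Lemma mean_value_bound (R : realType) (f df : R -> R) (x y k M : R) :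
  x <= y -> (forall t, x <= t <= y -> is_derive t 1 f (df t)) ->
  (forall t, x <= t <= y -> `|df t - k| <= M) ->
  `|f y - f x - k * (y - x)| <= M * (y - x).
Proof.
move=> xy fd dM.
have [||t txy E] := @MVT_segment R f df x y xy.
- by move=> t; rewrite in_itv /= => /andP[/ltW xt /ltW ty]; apply: fd; rewrite xt.
- apply: derivable_within_continuous => t; rewrite in_itv /= => txy.
  by have [] := fd t txy.
rewrite in_itv /= in txy; rewrite E -mulrBl normrM [X in _ * X]ger0_norm ?subr_ge0//.
by rewrite ler_wpM2r ?subr_ge0// dM.
Qed.

(* Green's formula without continuity of the partial derivatives: UF s and VF t
   are antiderivatives of U s and of V ^~ t, so that the two sides are the
   integrals of U dt and of V ds over opposite sides of the rectangle. *)
Lemma goursat_rectangle (R : realType) (U V UF VF : R -> R -> R) (a b c d : R) :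
  a < b -> c < d ->
  (forall s t, a <= s <= b -> c <= t <= d -> exists k l m, forall e, 0 < e ->
    exists2 r, 0 < r & forall s' t', a <= s' <= b -> c <= t' <= d ->
      `|s' - s| < r -> `|t' - t| < r ->
      `|U s' t' - U s t - k * (s' - s) - l * (t' - t)| <= e * (`|s' - s| + `|t' - t|)
      /\
      `|V s' t' - V s t - m * (s' - s) - k * (t' - t)| <= e * (`|s' - s| + `|t' - t|))
  ->
  (forall s t, a <= s <= b -> c <= t <= d -> is_derive t 1 (UF s) (U s t)) ->
  (forall s t, a <= s <= b -> c <= t <= d -> is_derive s 1 (VF t) (V s t)) ->
  UF b d - UF b c - (UF a d - UF a c) = VF d b - VF d a - (VF c b - VF c a).
Proof.
move=> ab cd dUV dUF dVF.
pose G x y u v := UF y v - UF y u - (UF x v - UF x u)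
  - (VF v y - VF v x - (VF u y - VF u x)).
apply/eqP; rewrite -subr_eq0; apply/eqP; rewrite -[LHS]/(G a b c d).
apply: bisection_null => //.
- by move=> x m y u v; rewrite /G; ring.
- by move=> x y u m v; rewrite /G; ring.
move=> s t sab tcd e e0; have [k [l [m H]]] := dUV s t sab tcd.
(* Each slope below is a difference of two values with error e / 4 * Z, hence has error e / 2 * Z;
   the lengths of the two sides then add up to [Z]. *)
have [r r0 Hr] := H (e / 4) ltac:(lra).
exists r => // x y u v ax xsy yb cu utv vd yxr vur.
set Z := (y - x) + (v - u).
have near1 s' t' : x <= s' <= y -> u <= t' <= v ->
    [/\ a <= s' <= b, c <= t' <= d, `|s' - s| < r, `|t' - t| < r &
        `|s' - s| + `|t' - t| <= Z].
  move=> Hs Ht.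
  have N1 : `|s' - s| <= y - x by rewrite ler_norml; lra.
  have N2 : `|t' - t| <= v - u by rewrite ler_norml; lra.
  by split; rewrite /Z; lra.
have near2 s' t' : x <= s' <= y -> u <= t' <= v ->
    `|U s' t' - U s t - k * (s' - s) - l * (t' - t)| <= e / 4 * Z /\
    `|V s' t' - V s t - m * (s' - s) - k * (t' - t)| <= e / 4 * Z.
  move=> Hs Ht; have [A1 A2 A3 A4 A5] := near1 s' t' Hs Ht.
  have [B1 B2] := Hr s' t' A1 A2 A3 A4.
  by split; [apply: le_trans B1 _|apply: le_trans B2 _]; rewrite ler_pM2l//; lra.
have Z0 : 0 <= Z by rewrite /Z; lra.
have HU : `|(UF y v - UF x v) - (UF y u - UF x u) - k * (y - x) * (v - u)|
    <= e / 2 * Z * (v - u).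
  apply: (@mean_value_bound R (fun t => UF y t - UF x t) (fun t => U y t - U x t)).
  - by lra.
  - move=> t' Ht; have [A1 A2 _ _ _] := near1 x t' ltac:(lra) Ht.
    by apply: is_deriveB; apply: dUF => //; lra.
  - move=> t' Ht.
    have [A1 _] := near2 x t' ltac:(lra) Ht; have [A2 _] := near2 y t' ltac:(lra) Ht.
    rewrite (_ : _ - _ = (U y t' - U s t - k * (y - s) - l * (t' - t))
      - (U x t' - U s t - k * (x - s) - l * (t' - t))); last by ring.
    by apply: le_trans (ler_normB _ _) _; lra.
have HV : `|(VF v y - VF u y) - (VF v x - VF u x) - k * (v - u) * (y - x)|
    <= e / 2 * Z * (y - x).
  apply: (@mean_value_bound R (fun s => VF v s - VF u s) (fun s => V s v - V s u)).
  - by lra.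
  - move=> s' Hs; have [A1 A2 _ _ _] := near1 s' u Hs ltac:(lra).
    by apply: is_deriveB; apply: dVF => //; lra.
  - move=> s' Hs.
    have [_ A1] := near2 s' u Hs ltac:(lra); have [_ A2] := near2 s' v Hs ltac:(lra).
    rewrite (_ : _ - _ = (V s' v - V s t - m * (s' - s) - k * (v - t))
      - (V s' u - V s t - m * (s' - s) - k * (u - t))); last by ring.
    by apply: le_trans (ler_normB _ _) _; lra.
(* The linear parts cancel because the same [k] is the s-derivative of U and the t-derivative of
   V. *)
rewrite /G (_ : _ - _ = ((UF y v - UF x v) - (UF y u - UF x u) - k * (y - x) * (v - u))
  - ((VF v y - VF u y) - (VF v x - VF u x) - k * (v - u) * (y - x))); last by ring.
apply: le_trans (ler_normB _ _) _; apply: le_trans (lerD HU HV) _.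
rewrite (_ : _ + _ = e / 2 * Z ^+ 2); last by rewrite /Z; ring.
by rewrite ler_wpM2r ?sqr_ge0//; lra.
Qed.

Lemma continuous_antiderivative (R : realType) (f : R -> R) (A B : R) : A < B ->
  (forall x, A <= x <= B -> {for x, continuous f}) ->
  exists F : R -> R, forall x, A < x < B -> is_derive x 1 F (f x).
Proof.
move=> AB fc.
have fi : lebesgue_measure.-integrable `[A, B] (EFin \o f).
  apply: continuous_compact_integrable; first exact: segment_compact.
  apply: continuous_subspace_itv => x; rewrite in_itv /=; exact: fc.
pose F x := \int[lebesgue_measure]_(t in `[A, x]) f t.
exists F => x /andP[Ax xB].
have [D E] : derivable F x 1 /\ F^`()%classic x = f x.
  by apply: (continuous_FTC1_closed xB fi Ax); apply: fc; rewrite !ltW.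
by rewrite -E derive1E; apply/derivableP.
Qed.

(** * The Schwarz lemma *)

Lemma is_deriveP (K : numFieldType) (f : K -> K) (x l : K) :
  is_derive x 1 f l <->
  (forall e, 0 < e -> exists2 r, 0 < r &
    forall h, `|h| < r -> `|f (x + h) - f x - l * h| <= e * `|h|).
Proof.
split=> [[fd fl] e e0|H].
  have : (fun h => h^-1 *: (f (h *: 1 + x) - f x)) @ 0^' --> l.
    by rewrite -fl /derive; exact: fd.
  move=> /cvgrPdist_le /(_ e e0); rewrite near_withinE => /nbhs_ballP[r /= r0 Hr].
  exists r => // h hr; have [->|h0] := eqVneq h 0.
    by rewrite mulr0 addr0 !subr0 subrr normr0 mulr0.
  have /(_ h) := Hr; rewrite /ball /= sub0r normrN => /(_ hr h0) E.
  rewrite distrC; have -> : l * h - (f (x + h) - f x) =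
     h * (l - h^-1 *: (f (h *: 1 + x) - f x)).
    by rewrite mulrBr mulrC /GRing.scale /= mulrA divff// mul1r mulr1 (addrC h).
  by rewrite normrM mulrC ler_wpM2r.
suff E : (fun h => h^-1 *: (f (h *: 1 + x) - f x)) @ 0^' --> l.
  split; first by apply/cvg_ex; exists l.
  by apply: cvg_lim => //; exact: norm_hausdorff.
apply/cvgrPdist_le => e e0; have [r r0 Hr] := H e e0.
rewrite near_withinE; apply/nbhs_ballP; exists r => // h; rewrite /ball /= sub0r normrN.
move=> hr h0; have := Hr h hr.
rewrite distrC; have -> : l * h - (f (x + h) - f x) =
     h * (l - h^-1 *: (f (h *: 1 + x) - f x)).
    by rewrite mulrBr mulrC /GRing.scale /= mulrA divff// mul1r mulr1 (addrC h).
by rewrite normrM mulrC ler_pM2r// normr_gt0.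
Qed.

Lemma is_derive_realP (R : realType) (f : R -> R) (x l : R) :
  is_derive x 1 f l <->
  (forall e : R, 0 < e -> exists2 r : R, 0 < r &
    forall h : R, `|h| < r -> `|f (x + h) - f x - l * h| <= e * `|h|).
Proof.
split=> [/is_deriveP H e e0|H]; first by have [r r0 Hr] := H e e0; exists r.
by apply/is_deriveP => e e0; have [r r0 Hr] := H e e0; exists r.
Qed.

Lemma normcE (R : realType) (x : R[i]) : `|x| = (modC x)%:C%C.
Proof. by []. Qed.

Lemma modC_ge0 (R : realType) (x : R[i]) : 0 <= modC x.
Proof. by rewrite -lecR; exact: (normr_ge0 x). Qed.

Lemma modCM (R : realType) (x y : R[i]) : modC (x * y) = modC x * modC y.
Proof. exact: ComplexField.Normc.normcM. Qed.

Lemma ler_modCD (R : realType) (x y : R[i]) : modC (x + y) <= modC x + modC y.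
Proof. exact: le_normcD. Qed.

Lemma modCN (R : realType) (x : R[i]) : modC (- x) = modC x.
Proof. exact: normcN. Qed.

Lemma modC0 (R : realType) : modC (0 : R[i]) = 0.
Proof. exact: ComplexField.Normc.normc0. Qed.

Lemma modC1 (R : realType) : modC (1 : R[i]) = 1.
Proof. exact: ComplexField.Normc.normc1. Qed.

Lemma modCV (R : realType) (x : R[i]) : modC x^-1 = (modC x)^-1.
Proof. exact: ComplexField.Normc.normcV. Qed.

Lemma modC_eq0 (R : realType) (x : R[i]) : (modC x == 0) = (x == 0).
Proof.
by apply/eqP/eqP => [/ComplexField.Normc.eq0_normc//|->]; rewrite modC0.
Qed.

Lemma modC_real (R : realType) (x : R) : modC x%:C%C = `|x|.
Proof. by rewrite /modC /= expr0n addr0 sqrtr_sqr. Qed.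

Lemma sqr_modC (R : realType) (x : R[i]) :
  modC x ^+ 2 = complex.Re x ^+ 2 + complex.Im x ^+ 2.
Proof. by case: x => a b; rewrite /modC /= sqr_sqrtr// addr_ge0// sqr_ge0. Qed.

Lemma Re_le_modC (R : realType) (x : R[i]) : `|complex.Re x| <= modC x.
Proof.
rewrite -ler_sqr ?nnegrE// ?modC_ge0// sqr_modC real_normK ?num_real//.
by rewrite lerDl sqr_ge0.
Qed.

Lemma Im_le_modC (R : realType) (x : R[i]) : `|complex.Im x| <= modC x.
Proof.
rewrite -ler_sqr ?nnegrE// ?modC_ge0// sqr_modC real_normK ?num_real//.
by rewrite lerDr sqr_ge0.
Qed.

Lemma modC_le_ReIm (R : realType) (x : R[i]) :
  modC x <= `|complex.Re x| + `|complex.Im x|.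
Proof.
rewrite -ler_sqr ?nnegrE// ?modC_ge0 ?addr_ge0// sqr_modC sqrrD.
rewrite !real_normK ?num_real// -addrA [X in _ <= _ + X]addrC addrA lerDl.
by rewrite mulrn_wge0// mulr_ge0.
Qed.

(** A positive element of [R[i]] is real, so the tolerance and the radius can be taken in [R] and
    the norm replaced by the real-valued modulus. *)
Lemma is_derive_modCP (R : realType) (f : Cx R -> Cx R) (x l : Cx R) :
  is_derive x 1 f l <->
  (forall e : R, 0 < e -> exists2 r : R, 0 < r &
    forall h, modC h < r -> modC (f (x + h) - f x - l * h) <= e * modC h).
Proof.
split=> [/is_deriveP H e e0|H].
  have [|[r ri]] := H e%:C%C; first by rewrite ltcR.
  rewrite ltcE /= => /andP[/eqP -> r0] Hr; exists r => // h hr.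
  have /(_ _)/wrap[] := Hr h; first by rewrite normcE ltcR.
  by rewrite !normcE -rmorphM lecR.
apply/is_deriveP => -[e ei]; rewrite ltcE /= => /andP[/eqP -> e0].
have [r r0 Hr] := H e e0; exists r%:C%C; first by rewrite ltcR.
move=> h; rewrite normcE ltcR => /Hr.
by rewrite !normcE -[Complex _ _]/(e%:C%C) -rmorphM lecR.
Qed.

Definition cexp (R : realType) (w : Cx R) : Cx R :=
  ((expR (complex.Re w) * cos (complex.Im w)) +i*
   (expR (complex.Re w) * sin (complex.Im w)))%C.

Lemma cexpD (R : realType) (x y : Cx R) : cexp (x + y) = cexp x * cexp y.
Proof.
case: x y => a b [c d]; rewrite /cexp /= expRD cosD sinD.
by apply/eqP; rewrite eq_complex /=; apply/andP; split; apply/eqP; ring.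
Qed.

Lemma cexp0 (R : realType) : cexp (0 : Cx R) = 1.
Proof. by rewrite /cexp /= expR0 cos0 sin0 mulr1 mulr0. Qed.

Lemma modC_cexp (R : realType) (x : Cx R) : modC (cexp x) = expR (complex.Re x).
Proof.
apply/eqP; rewrite -(@eqrXn2 _ 2)// ?modC_ge0 ?expR_ge0// sqr_modC /=.
by rewrite !exprMn -mulrDr cos2Dsin2 mulr1.
Qed.

(** The addition formula reduces the claim to the origin, where it follows from the derivatives at 0
    of exp, cos and sin. *)
Lemma is_derive_cexp (R : realType) (x : Cx R) : is_derive x 1 (@cexp R) (cexp x).
Proof.
apply/is_derive_modCP => e e0.
suff [r r0 Hr] : exists2 r : R, 0 < r & forall h : Cx R, modC h < r ->
    modC (cexp h - 1 - h) <= e / modC (cexp x) * modC h.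
  exists r => // h /Hr H; rewrite cexpD.
  have -> : cexp x * cexp h - cexp x - cexp x * h = cexp x * (cexp h - 1 - h).
    by ring.
  have m0 : 0 < modC (cexp x) by rewrite modC_cexp expR_gt0.
  rewrite modCM; apply: le_trans (ler_wpM2l (ltW m0) H) _.
  by rewrite mulrA mulrCA divff ?mulr1// gt_eqF.
have : 0 < e / modC (cexp x) by rewrite divr_gt0// modC_cexp expR_gt0.
move: (e / modC _) => {e0}e e0.
(* The real and imaginary parts of the remainder are bounded in [B1] and [B2] by 4 and 5 times d
   |h|, so e / 12 leaves room to spare. *)
pose d := Num.min (e / 12) 1.
have d0 : 0 < d by rewrite lt_min ltr01 andbT divr_gt0.
have de : d <= e / 12 by rewrite ge_min lexx.
have d1 : d <= 1 by rewrite ge_min lexx orbT.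
clearbody d.
have /is_derive_realP /(_ d d0) [r1 r10 H1] := is_derive_expR (0 : R).
have /is_derive_realP /(_ d d0) [r2 r20 H2] := is_derive_cos (0 : R).
have /is_derive_realP /(_ d d0) [r3 r30 H3] := is_derive_sin (0 : R).
(* The radius is also kept below [d] because the cross term (e^s - 1) t is only bounded by 2
   |h|^2. *)
exists (Num.min (Num.min r1 r2) (Num.min r3 d)).
  by rewrite !lt_min r10 r20 r30 d0.
move=> h; rewrite !lt_min => /andP[/andP[hr1 hr2] /andP[hr3 hd]].
have Re_h := Re_le_modC h; have Im_h := Im_le_modC h.
have {H1} := H1 _ (le_lt_trans Re_h hr1).
have {H2} := H2 _ (le_lt_trans Im_h hr2).
have {H3} := H3 _ (le_lt_trans Im_h hr3).
rewrite !add0r expR0 cos0 sin0 oppr0 mul0r !subr0 ?addr0 !mul1r => H3 H2 H1.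
apply: le_trans (modC_le_ReIm _) _.
move: Re_h Im_h hd; move: (modC h) (modC_ge0 h) => m m0.
case: h {hr1 hr2 hr3} H1 H2 H3 => s t /= H1 H2 H3 Re_h Im_h hd.
have E1 : `|expR s - 1| <= 2 * m.
  rewrite (_ : _ - _ = expR s - 1 - s + s); last by ring.
  apply: le_trans (ler_normD _ _) _.
  have : d * `|s| <= 1 * m by apply: ler_pM => //; exact: ltW.
  lra.
have E2 : expR s <= 3.
  by have := ler_norm (expR s - 1); lra.
have dm : d * m <= e / 12 * m by rewrite ler_wpM2r.
have dt : d * `|t| <= d * m by rewrite ler_pM2l.
have ds : d * `|s| <= d * m by rewrite ler_pM2l.
have B1 : `|expR s * cos t - 1 - s| <= 3 * (d * m) + d * m.
  rewrite (_ : _ - _ = expR s * (cos t - 1) + (expR s - 1 - s)); last by ring.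
  apply: le_trans (ler_normD _ _) _; apply: lerD; last by lra.
  by rewrite normrM ger0_norm ?expR_ge0// ler_pM ?expR_ge0//; lra.
have B2 : `|expR s * sin t - 0 - t| <= 3 * (d * m) + 2 * (d * m).
  rewrite (_ : _ - _ = expR s * (sin t - t) + (expR s - 1) * t); last by ring.
  apply: le_trans (ler_normD _ _) _; apply: lerD.
    by rewrite normrM ger0_norm ?expR_ge0// ler_pM ?expR_ge0//; lra.
  rewrite normrM; apply: le_trans (ler_pM _ _ E1 Im_h) _ => //.
  by rewrite -mulrA ler_pM2l// ler_wpM2r//; lra.
have em : 0 <= e * m by rewrite mulr_ge0// ltW.
lra.
Qed.

Lemma cexp_2pi (R : realType) (s : R) :
  cexp (s +i* (pi *+ 2))%C = cexp (s +i* 0)%C.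
Proof. by rewrite /cexp /= cos2pi sin2pi cos0 sin0. Qed.

(* In the coordinate w = log zeta the function h(zeta)/zeta is holomorphic on
   the left half-plane and 2 pi i-periodic, so that its mean over a vertical
   period does not depend on Re w; it tends to h'(0) as Re w tends to -oo. *)
Lemma schwarz_derive (R : realType) (h : Cx R -> Cx R) :
  (forall x : Cx R, modC x < 1 -> differentiable h x) ->
  (forall x : Cx R, modC x < 1 -> modC (h x) <= 1) -> h 0 = 0 ->
  modC ('D_1 h 0) <= 1.
Proof.
move=> hd h1 h0; rewrite leNgt; apply/negP.
set c := 'D_1 h 0; set m := modC c => m1.
have m0 : 0 < m by apply: lt_trans m1.
(* This unimodular factor rotates the derivative to the positive real number [m], so that real parts
   suffice from here on. *)
pose u : Cx R := m%:C%C / c.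
have mu : modC u = 1.
  by rewrite modCM modCV modC_real gtr0_norm// divff// gt_eqF.
have uc : u * c = m%:C%C by rewrite divfK// -modC_eq0 gt_eqF.
clearbody u.
(* On the circle of radius expR s1 = m^(-1/2), which lies inside the disc since m > 1, the bound |h|
   <= 1 gives |h(zeta)/zeta| <= sqrt m < m. *)
pose s1 : R := - ln m / 2.
have lnm : 0 < ln m by rewrite ln_gt0.
have s1n : s1 < 0 by rewrite /s1; lra.
have e1 : expR (- s1) < m.
  by rewrite -ltr_ln ?posrE ?expR_gt0// expRK /s1; lra.
pose e := (m - expR (- s1)) / 2.
have e0 : 0 < e by rewrite /e; lra.
have /is_derive_modCP /(_ e e0) [r r0 Hr] : is_derive (0 : Cx R) 1 h c.
  by apply/derivableP/derivable1_diffP/hd; rewrite modC0 ltr01.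
(* The circle of radius expR s0 is smaller than the previous one and lies where h(zeta)/zeta is
   within [e] of [c]. *)
pose s0 := Num.min (ln r) s1 - 1.
have s01 : s0 < s1.
  rewrite /s0; have : Num.min (ln r) s1 <= s1 by rewrite ge_min lexx orbT.
  move: (Num.min _ _) => q; lra.
have s0r : expR s0 < r.
  rewrite -ltr_ln ?posrE ?expR_gt0// expRK /s0.
  have : Num.min (ln r) s1 <= ln r by rewrite ge_min lexx.
  move: (Num.min _ _) => q; lra.
pose H (w : Cx R) : Cx R := u * (h (cexp w) * cexp (- w)).
have cexp1 (w : Cx R) : complex.Re w < 0 -> modC (cexp w) < 1.
  by rewrite modC_cexp -expR0 ltr_expR.
have HE (w : Cx R) : cexp w * cexp (- w) = 1 by rewrite -cexpD subrr cexp0.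
have Hd (w : Cx R) : complex.Re w < 0 -> exists l, is_derive w 1 H l.
  move=> w0; exists ('D_1 H w); apply/derivableP/derivable1_diffP.
  have cd (x : Cx R) : differentiable (@cexp R) x.
    by apply/derivable1_diffP; have [] := is_derive_cexp x.
  apply: differentiableM; first exact: differentiable_cst.
  apply: differentiableM.
    by apply: (@differentiable_comp _ _ _ _ (@cexp R) h) => //; apply/hd/cexp1.
  apply: (@differentiable_comp _ _ _ _ (- (@id (Cx R))) (@cexp R)); last exact: cd.
  by apply: (@differentiableN _ _ _ (@id (Cx R))); exact: ex_diff.
pose U s t := complex.Re (H (s +i* t)%C); pose V s t := complex.Im (H (s +i* t)%C).
have UV (s t : R) : s < 0 -> exists k l n : R, forall e : R, 0 < e ->
    exists2 r : R, 0 < r & forall s' t' : R, `|s' - s| < r -> `|t' - t| < r ->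
     `|U s' t' - U s t - k * (s' - s) - l * (t' - t)| <= e * (`|s' - s| + `|t' - t|)
      /\
     `|V s' t' - V s t - n * (s' - s) - k * (t' - t)| <= e * (`|s' - s| + `|t' - t|).
  move=> sn; have [[k n] /is_derive_modCP HH] := Hd (s +i* t)%C sn.
  (* Cauchy-Riemann equations: if H' = k + i n, then U has partial derivatives k, -n and V has n,
     k. *)
  exists k, (- n), n => e' e'0; have [r' r'0 Hr'] := HH e' e'0.
  exists (r' / 2); first by rewrite divr_gt0.
  move=> s' t' Hs Ht; pose v : Cx R := ((s' - s) +i* (t' - t))%C.
  have vb : modC v <= `|s' - s| + `|t' - t| := modC_le_ReIm v.
  have /Hr' Hv : modC v < r' by lra.
  have E : ((s +i* t)%C : Cx R) + v = (s' +i* t')%C.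
    by rewrite /v; apply/eqP; rewrite eq_complex /=; apply/andP; split; apply/eqP; ring.
  rewrite E in Hv.
  have {Hv}Hv : modC (H (s' +i* t')%C - H (s +i* t)%C - (k +i* n)%C * v) <=
    e' * (`|s' - s| + `|t' - t|) by apply: le_trans Hv _; rewrite ler_pM2l.
  split.
    apply: le_trans Hv; apply: le_trans (Re_le_modC _).
    rewrite /U /v; move: (H _) (H _) => [a b] [a' b'] /=.
    by rewrite le_eqVlt; apply/orP; left; apply/eqP; congr `| _ |; ring.
  apply: le_trans Hv; apply: le_trans (Im_le_modC _).
  rewrite /V /v; move: (H _) (H _) => [a b] [a' b'] /=.
  by rewrite le_eqVlt; apply/orP; left; apply/eqP; congr `| _ |; ring.
have AK (x y : R) : x + y - x = y by rewrite addrAC subrr add0r.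
have Uc (s t : R) : s < 0 -> {for t, continuous (U s)}.
  move=> sn; have [k [l [n HH]]] := UV s t sn.
  have /@ex_derive/derivable1_diffP : is_derive t 1 (U s) l.
    apply/is_derive_realP => e' e'0; have [r' r'0 Hr'] := HH e' e'0; exists r' => // v vr.
    have [] := Hr' s (t + v); rewrite !(subrr, AK, normr0)//.
    by rewrite mulr0 subr0 add0r.
  exact: differentiable_continuous.
have Vc (s t : R) : s < 0 -> {for s, continuous (V^~ t)}.
  move=> sn; have [k [l [n HH]]] := UV s t sn.
  have /@ex_derive/derivable1_diffP : is_derive s 1 (V^~ t) n.
    apply/is_derive_realP => e' e'0; have [r' r'0 Hr'] := HH e' e'0; exists r' => // v vr.
    have [] := Hr' (s + v) t; rewrite !(subrr, AK, normr0)//.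
    by rewrite !(mulr0, subr0, addr0).
  exact: differentiable_continuous.
pose p2 : R := pi *+ 2; have p20 : 0 < p2 by rewrite mulrn_wgt0// pi_gt0.
(* The antiderivative is chosen as an operator [J] on functions, with the dummy value [id] on
   discontinuous ones. Equal integrands thus get the same antiderivative, without a constant to
   adjust. *)
have anti (A B : R) : A < B -> exists J : (R -> R) -> R -> R, forall f : R -> R,
    (forall x : R, A <= x <= B -> {for x, continuous f}) ->
    forall x : R, A < x < B -> is_derive x 1 (J f) (f x).
  move=> AB; pose P (f F : R -> R) :=
    (forall x : R, A <= x <= B -> {for x, continuous f}) ->
    forall x : R, A < x < B -> is_derive x 1 F (f x).
  suff /choice[J HJ] : forall f, exists F, P f F by exists J.
  move=> f; have [fc|nfc] := pselect (forall x : R, A <= x <= B -> {for x, continuous f}).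
    by have [F HF] := continuous_antiderivative AB fc; exists F => _.
  by exists id => /nfc.
(* The intervals exceed [0, p2] and [s0, s1] because derivatives are only given in the interior; s1
   / 2 is still negative, as the continuity of V requires. *)
have [JU HJU] := anti (-1) (p2 + 1) ltac:(lra).
have [JV HJV] := anti (s0 - 1) (s1 / 2) ltac:(lra).
have := @goursat_rectangle R U V (fun s => JU (U s)) (fun t => JV (V^~ t)) s0 s1 0 p2
  s01 p20.
have dU s t : s0 <= s <= s1 -> 0 <= t <= p2 -> is_derive t 1 (JU (U s)) (U s t).
  by move=> Hs Ht; apply: HJU => [x _|]; [apply: Uc|]; lra.
have dV s t : s0 <= s <= s1 -> 0 <= t <= p2 -> is_derive s 1 (JV (V^~ t)) (V s t).
  by move=> Hs Ht; apply: HJV => [x Hx|]; [apply: Vc|]; lra.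
(* By periodicity the two horizontal sides of the rectangle contribute the same integral, and
   Green's formula equates the vertical ones. *)
have VE : V^~ p2 = V^~ 0.
  apply/funext => s; rewrite /V /H; congr (complex.Im (u * _)).
  by rewrite cexp_2pi /cexp /= cosN sinN oppr0 cos0 sin0 cos2pi sin2pi oppr0.
rewrite VE subrr => /(_ _ dU dV) G.
have {}G : JU (U s1) p2 - JU (U s1) 0 = JU (U s0) p2 - JU (U s0) 0.
  apply/eqP; rewrite -subr_eq0 G// => s t Hs _.
  have [k [l [n HH]]] := UV s t ltac:(lra); exists k, l, n => e' e'0.
  by have [r' r'0 Hr'] := HH e' e'0; exists r' => // s' t' _ _; exact: Hr'.
have Hb (w : Cx R) : complex.Re w < 0 -> modC (H w) <= expR (- complex.Re w).
  move=> w0; rewrite /H !modCM mu mul1r modC_cexp raddfN /=.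
  by rewrite ler_piMl ?expR_ge0// h1// cexp1.
(* The common value of the two vertical integrals is at most expR (- s1) * p2 by [B1], but within e
   * p2 of m * p2 by [B0]; the choice of [e] excludes this. *)
have B1 : `|JU (U s1) p2 - JU (U s1) 0 - 0 * (p2 - 0)| <= expR (- s1) * (p2 - 0).
  apply: (@mean_value_bound R _ (U s1)); first exact: ltW.
    by move=> t Ht; apply: dU => //; lra.
  move=> t Ht; rewrite subr0; apply: le_trans (Re_le_modC _) _.
  exact: (Hb (s1 +i* t)%C).
have B0 : `|JU (U s0) p2 - JU (U s0) 0 - m * (p2 - 0)| <= e * (p2 - 0).
  apply: (@mean_value_bound R _ (U s0)); first exact: ltW.
    by move=> t Ht; apply: dU => //; lra.
  move=> t Ht; pose w : Cx R := (s0 +i* t)%C.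
  have s0n : s0 < 0 by lra.
  have -> : U s0 t - m = complex.Re (u * ((h (cexp w) - c * cexp w) * cexp (- w))).
    rewrite mulrBl -mulrA HE mulr1 mulrBr uc raddfB /=; congr (_ - _).
  apply: le_trans (Re_le_modC _) _; rewrite !modCM mu mul1r.
  have := Hr (cexp w); rewrite add0r h0 subr0 !modC_cexp => /(_ s0r) Hw.
  have -> : complex.Re (- w) = - s0 by [].
  rewrite -[leRHS]mulr1 -(expRxMexpNx_1 s0) mulrA.
  by rewrite ler_pM2r ?expR_gt0.
have e12 : e + expR (- s1) < m by rewrite /e; lra.
rewrite mul0r !subr0 in B1; rewrite subr0 in B0; rewrite -G in B0.
have : m * p2 <= (e + expR (- s1)) * p2.
  by move: B1 B0; rewrite !ler_norml mulrDl; lra.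
by rewrite ler_pM2r// leNgt e12.
Qed.

(** * Sublinear functionals and supporting hyperplanes *)

(** Only real scalars are pulled out: the complex space is treated as a real one until the
    functionals are complexified. *)
Definition sublinear (R : realType) (V : lmodType R[i]) (g : V -> R) : Prop :=
  (forall x y, g (x + y) <= g x + g y) /\
  (forall (t : R) x, 0 < t -> g (t%:C%C *: x) = t * g x).

Lemma sublinear0 (R : realType) (V : lmodType R[i]) (g : V -> R) :
  sublinear g -> g 0 = 0.
Proof. by move=> [_ gZ]; have := gZ 2 0 ltac:(lra); rewrite scaler0; lra. Qed.

Lemma sublinear_opp (R : realType) (V : lmodType R[i]) (g : V -> R) x :
  sublinear g -> - g (- x) <= g x.
Proof.
move=> sg; have [gD _] := sg; have := gD x (- x).
by rewrite subrr sublinear0//; lra.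
Qed.

(* The largest sublinear minorant of g that is linear along v. *)
Lemma sublinear_linearize (R : realType) (V : lmodType R[i]) (g : V -> R) v :
  sublinear g -> exists g' : V -> R,
    [/\ sublinear g', forall x, g' x <= g x, g' v = g v & g' (- v) = - g v].
Proof.
move=> sg; have [gD gZ] := sg.
pose A x := [set g (x + t%:C%C *: v) - t * g v | t in [set t : R | 0 <= t]].
pose g' x := inf (A x).
have gZ0 (t : R) : 0 <= t -> g (t%:C%C *: v) = t * g v.
  rewrite le_eqVlt => /predU1P[<-|t0]; last exact: gZ.
  by rewrite scale0r sublinear0// mul0r.
have Ae x t : 0 <= t -> A x (g (x + t%:C%C *: v) - t * g v) by move=> t0; exists t.
have Alb x : lbound (A x) (- g (- x)).
  move=> _ [t t0 <-]; have := gD (x + t%:C%C *: v) (- x).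
  by rewrite addrAC subrr add0r gZ0//; lra.
have le_g' x t : 0 <= t -> g' x <= g (x + t%:C%C *: v) - t * g v.
  by move=> t0; apply: ge_inf; [exists (- g (- x))|exact: Ae].
have ge_g' x b : (forall t : R, 0 <= t -> b <= g (x + t%:C%C *: v) - t * g v) -> b <= g' x.
  move=> H; apply: lb_le_inf; first by exists (g (x + 0%:C%C *: v) - 0 * g v); exact: Ae.
  by move=> _ [t t0 <-]; exact: H.
have g'_g x : g' x <= g x.
  by have := le_g' x 0 (lexx _); rewrite scale0r addr0 mul0r subr0.
have g'D x y : g' (x + y) <= g' x + g' y.
  rewrite -lerBlDr; apply: (ge_g') => s s0.
  rewrite lerBlDr -lerBlDl; apply: (ge_g') => t t0.
  have := le_g' (x + y) (s + t) (addr_ge0 s0 t0).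
  have := gD (x + s%:C%C *: v) (y + t%:C%C *: v).
  by rewrite addrACA -scalerDl -rmorphD /=; lra.
have g'Z1 (t : R) x : 0 < t -> g' (t%:C%C *: x) <= t * g' x.
  move=> t0; rewrite -ler_pdivrMl//; apply: ge_g' => s s0.
  rewrite ler_pdivrMl// mulrBr -(gZ t)// scalerDr scalerA -rmorphM mulrA.
  by apply: le_g'; rewrite mulr_ge0// ltW.
have sg' : sublinear g'.
  split=> // t x t0; apply: le_anti; rewrite g'Z1//=.
  have := @g'Z1 t^-1 (t%:C%C *: x); rewrite invr_gt0 => /(_ t0).
  rewrite scalerA -rmorphM mulVf ?gt_eqF//= scale1r mulrC => H.
  by rewrite -ler_pdivlMl// mulrC.
have gv := g'_g v; have g'Nv : g' (- v) <= - g v.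
  by have := le_g' (- v) 1 ler01; rewrite scale1r addNr sublinear0// mul1r sub0r.
have := sublinear_opp v sg'.
by exists g'; split => //; lra.
Qed.

(** Since - q (- v) <= q v, a minorant is squeezed to equality along [v]. Linearity gained along one
    vector therefore survives all later linearizations. *)
Lemma sublinear_le_linear (R : realType) (V : lmodType R[i]) (g q : V -> R) v :
  sublinear q -> (forall x, q x <= g x) -> g (- v) = - g v ->
  q v = g v /\ q (- v) = - q v.
Proof.
by move=> sq qg gv; have := sublinear_opp v sq; have := qg v; have := qg (- v); lra.
Qed.

Lemma sublinear_linearize_seq (R : realType) (V : lmodType R[i]) (g : V -> R)
    (s : seq V) : sublinear g ->
  exists q : V -> R, [/\ sublinear q, forall x, q x <= g x &
    forall v, v \in s -> q (- v) = - q v].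
Proof.
move=> sg; elim: s => [|v s [q [sq qg qs]]]; first by exists g; split.
have [q' [sq' q'q q'v q'Nv]] := sublinear_linearize v sq.
exists q'; split => //; first by move=> x; apply: le_trans (qg x).
move=> w; rewrite inE => /predU1P[->|ws]; first by rewrite q'Nv q'v.
by have [] := sublinear_le_linear sq' q'q (qs w ws).
Qed.

(** Finite-dimensional Hahn-Banach: linearizing first along [p] fixes the value there, and
    linearizing next along the vectors e_k and i e_k, a real basis, makes the minorant real-linear
    everywhere. *)
Lemma sublinear_support (R : realType) (n : nat) (g : 'CV[R]_n -> R) (p : 'CV[R]_n) :
  sublinear g -> exists c : 'M[Cx R]_(n, 1),
    (forall x, complex.Re ((x *m c) 0 0) <= g x) /\ complex.Re ((p *m c) 0 0) = g p.
Proof.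
move=> sg; have [g1 [sg1 g1g g1p g1Np]] := sublinear_linearize p sg.
pose e k : 'CV[R]_n := delta_mx 0 k.
pose s := [seq e k | k <- enum 'I_n] ++ [seq ('i%C : R[i]) *: e k | k <- enum 'I_n].
have [q [sq qg1 qs]] := sublinear_linearize_seq s sg1.
have qe k : q (- e k) = - q (e k) by rewrite qs// mem_cat map_f// mem_enum.
have qi k : q (- (('i%C : R[i]) *: e k)) = - q (('i%C : R[i]) *: e k).
  by rewrite qs// mem_cat (@map_f _ _ (fun k => _ *: e k)) ?orbT// mem_enum.
have [qD qZ] := sq.
have linD x v : q (- v) = - q v -> q (x + v) = q x + q v.
  move=> qv; have := qD x v; have := qD (x + v) (- v); rewrite addrK qv; lra.
have linZ (t : R) v : q (- v) = - q v -> q (t%:C%C *: v) = t * q v.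
  move=> qv; case: (ltrgt0P t) => [t0|t0|->]; first exact: qZ.
    have := qZ (- t) (- v); rewrite oppr_gt0 => /(_ t0).
    by rewrite rmorphN scaleNr scalerN opprK qv mulrNN.
  by rewrite scale0r (sublinear0 sq) mul0r.
have linZN (t : R) v : q (- v) = - q v -> q (- (t%:C%C *: v)) = - q (t%:C%C *: v).
  by move=> qv; rewrite -scaleNr -rmorphN !linZ// mulNr.
(* Values at the e_k of the complexification x |-> q x - i q (i x), whose real part is [q]. *)
pose c : 'M[Cx R]_(n, 1) := \matrix_(k, j) (q (e k) +i* (- q (('i%C : R[i]) *: e k)))%C.
have qE x : q x = complex.Re ((x *m c) 0 0).
  rewrite {1}(row_sum_delta x) mxE raddf_sum /=.
  suff H (r : seq 'I_n) : q (\sum_(j <- r) x 0 j *: e j) =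
      \sum_(j <- r) complex.Re (x 0 j * c j 0) by rewrite H.
  elim: r => [|j r IH]; first by rewrite !big_nil sublinear0.
  rewrite !big_cons addrC [RHS]addrC.
  have -> : x 0 j *: e j = (complex.Re (x 0 j))%:C%C *: e j +
      (complex.Im (x 0 j))%:C%C *: (('i%C : R[i]) *: e j).
    by rewrite scalerA -scalerDl {1}[x 0 j]complexE (mulrC 'i%C).
  rewrite addrA !linD ?linZN// !linZ// IH -addrA; congr (_ + _).
  by rewrite mxE; case: (x 0 j) => a b /=; rewrite mulrN opprK.
exists c; split => [x|]; first by rewrite -qE; apply: le_trans (g1g x).
have [|qp _] := @sublinear_le_linear _ _ g1 q p sq qg1; first by rewrite g1Np g1p.
by rewrite -qE qp.
Qed.

Lemma is_convex_comb (R : realType) (n : nat) (D : set 'CV[R]_n) (x y : 'CV[R]_n) (t : R) :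
  is_convex D -> D x -> D y -> 0 <= t <= 1 -> D (t%:C%C *: x + (1 - t)%:C%C *: y).
Proof.
move=> cD Dx Dy /andP[t0 t1].
have h : Itv.spec (@Itv.num_sem R[i]) (Itv.Real `[0%Z, 1%Z]) t%:C%C.
  apply/and3P; split; last 2 first.
  - by rewrite /= bnd_simp lecR.
  - by rewrite /= bnd_simp lecR.
  - by apply/complex_realP; exists t.
have := cD x y (Itv.mk h) (mem_set Dx) (mem_set Dy); rewrite inE rmorphB.
exact.
Qed.

Lemma open_line (R : realType) (n : nat) (D : set 'CV[R]_n) (a b : 'CV[R]_n) :
  open D -> D a -> exists2 r : R, 0 < r & forall t : R[i], modC t < r -> D (a + t *: b).
Proof.
move=> oD Da.
have : nbhs (0 : Cx R) ((fun t : Cx R => a + t *: b) @^-1` D).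
  have c : {for (0 : Cx R), continuous (fun t : Cx R => a + t *: b)}.
    apply: (@continuousD _ _ _ (fun=> a)); first exact: cst_continuous.
    exact: scalel_continuous.
  apply: c; rewrite /= scale0r addr0.
  by move: oD; rewrite openE => /(_ a Da).
move=> /nbhs_ballP[[r ri]]; rewrite /= ltcE /= => /andP[/eqP -> r0] Hr.
exists r => // t tr; apply: Hr; rewrite /ball /= sub0r normrN normcE.
by rewrite -[Complex _ _]/(r%:C%C) ltcR.
Qed.

(** The Minkowski functional of D - z. *)
Definition gauge (R : realType) (n : nat) (D : set 'CV[R]_n) (z x : 'CV[R]_n) : R :=
  inf [set t : R | 0 < t /\ D (z + t^-1%:C%C *: x)].

Section gauge.
Variables (R : realType) (n : nat) (D : set 'CV[R]_n) (z : 'CV[R]_n).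
Hypotheses (oD : open D) (cD : is_convex D) (Dz : D z).
Implicit Types x y : 'CV[R]_n.

Local Notation g := (gauge D z).

Let A x := [set t : R | 0 < t /\ D (z + t^-1%:C%C *: x)].

Lemma gauge_inf x : has_inf (A x).
Proof.
split; last by exists 0 => t [/ltW].
have [r r0 Hr] := open_line x oD Dz; exists (r / 2)^-1; split.
  by rewrite invr_gt0 divr_gt0.
by rewrite invrK; apply: Hr; rewrite modC_real gtr0_norm; lra.
Qed.

Lemma gauge_le x (t : R) : 0 < t -> D (z + t^-1%:C%C *: x) -> g x <= t.
Proof. by move=> t0 Dt; apply: ge_inf; [exact: (gauge_inf x).2|split]. Qed.

Lemma gauge_ge x (b : R) :
  (forall t : R, 0 < t -> D (z + t^-1%:C%C *: x) -> b <= t) -> b <= g x.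
Proof. by move=> H; apply: lb_le_inf; [exact: (gauge_inf x).1|move=> t []; exact: H]. Qed.

Lemma gauge_ge0 x : 0 <= g x.
Proof. by apply: gauge_ge => t /ltW. Qed.

Lemma gauge_sublinear : sublinear g.
Proof.
have gZ (t : R) x : 0 < t -> g (t%:C%C *: x) <= t * g x.
  move=> t0; rewrite -ler_pdivrMl//; apply: gauge_ge => s s0 Ds.
  rewrite ler_pdivrMl//; apply: gauge_le; first by rewrite mulr_gt0.
  by rewrite scalerA -rmorphM invfM mulrAC mulVf ?mul1r// gt_eqF.
split=> [x y|t x t0].
  rewrite -lerBlDr; apply: gauge_ge => s s0 Ds.
  rewrite lerBlDr -lerBlDl; apply: gauge_ge => t t0 Dt.
  rewrite lerBlDl; have st0 : 0 < s + t by rewrite addr_gt0.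
  apply: gauge_le => //.
  have st1 : 0 <= s / (s + t) <= 1.
    by apply/andP; split; [rewrite divr_ge0// ltW|rewrite ler_pdivrMr// mul1r lerDl ltW].
  have := is_convex_comb cD Ds Dt st1.
  have -> : 1 - s / (s + t) = t / (s + t) by field; rewrite gt_eqF.
  have s1 : s / (s + t) * s^-1 = (s + t)^-1 by field; rewrite !gt_eqF.
  have t1 : t / (s + t) * t^-1 = (s + t)^-1 by field; rewrite !gt_eqF.
  rewrite !scalerDr !scalerA -!rmorphM s1 t1 addrACA -scalerDl -rmorphD.
  by rewrite -mulrDl divff ?scale1r// gt_eqF.
apply: le_anti; rewrite gZ//=.
have := @gZ t^-1 (t%:C%C *: x); rewrite invr_gt0 => /(_ t0).
rewrite scalerA -rmorphM mulVf ?gt_eqF//= scale1r => H.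
by rewrite -ler_pdivlMl.
Qed.

Lemma gauge_lt1 x : (g x < 1) <-> D (z + x).
Proof.
split=> [gx|Dx].
  have [t [t0 Dt] t1] := inf_lt (gauge_inf x).1 gx.
  have := is_convex_comb cD Dt Dz (t := t); rewrite !ltW// => /(_ isT).
  rewrite scalerDr scalerA -rmorphM divff ?gt_eqF// scale1r addrAC -scalerDl -rmorphD.
  have -> : t + (1 - t) = 1 by ring.
  by rewrite rmorph1 scale1r.
have [r r0 Hr] := open_line x oD Dx.
have r10 : 0 < 1 + r / 2 by lra.
apply: (@le_lt_trans _ _ (1 + r / 2)^-1); last by rewrite invf_lt1//; lra.
apply: gauge_le; rewrite ?invr_gt0// invrK rmorphD scalerDl scale1r addrA.
by apply: Hr; rewrite modC_real gtr0_norm; lra.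
Qed.

(** The point has gauge 1, so it is not in [D], while its slight contractions towards [z] have gauge
    below 1 and are in [D]. *)
Lemma gauge_bdry x : 0 < g x -> bdry D (z + (g x)^-1%:C%C *: x).
Proof.
move=> g0; have [_ gZ] := gauge_sublinear.
have gy : g ((g x)^-1%:C%C *: x) = 1 by rewrite gZ ?invr_gt0// mulVf ?gt_eqF.
move: (_ *: x) gy => y gy; split; last first.
  by move=> /interior_subset /gauge_lt1; rewrite gy ltxx.
move=> B; rewrite nbhsE => -[W [oW Wy] WB].
have [r r0 Hr] := open_line y oW Wy.
pose d := Num.min (r / 2) (1 / 2).
have dr : d <= r / 2 by rewrite ge_min lexx.
have d1 : d <= 1 / 2 by rewrite ge_min lexx orbT.
have d0 : 0 < d by rewrite lt_min; apply/andP; split; lra.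
clearbody d.
exists (z + y + (- d)%:C%C *: y); split; last first.
  by apply/WB/Hr; rewrite modC_real normrN gtr0_norm; lra.
rewrite -addrA -{1}[y]scale1r -scalerDl -[1]/(1%:C%C) -rmorphD.
by apply/gauge_lt1; rewrite gZ ?gy; lra.
Qed.

Lemma bdry_gauge q : bdry D q -> 1 <= g (q - z).
Proof.
move=> [_ Dq]; rewrite leNgt; apply/negP => /gauge_lt1.
by rewrite addrC subrK => Dq'; apply: Dq; move/interior_id: oD => ->.
Qed.

End gauge.

(** * The orthogonal flag of boundary points *)

Lemma enorm_ge0 (R : realType) (n : nat) (v : 'CV[R]_n) : 0 <= enorm v.
Proof. exact: sqrtr_ge0. Qed.

Lemma sqr_enorm (R : realType) (n : nat) (v : 'CV[R]_n) :
  enorm v ^+ 2 = \sum_(i < n) modC (v 0 i) ^+ 2.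
Proof. by rewrite sqr_sqrtr// sumr_ge0// => i _; rewrite sqr_ge0. Qed.

Lemma enorm_dotmx (R : realType) (n : nat) (v : 'CV[R]_n) :
  (enorm v ^+ 2)%:C%C = dotmx v v.
Proof.
rewrite sqr_enorm dotmxE mxE rmorph_sum; apply: eq_bigr => i _.
by rewrite !mxE rmorphXn /= -normcE sqr_normc.
Qed.

Lemma enormZ (R : realType) (n : nat) (t : R[i]) (v : 'CV[R]_n) :
  enorm (t *: v) = modC t * enorm v.
Proof.
apply/eqP; rewrite -(@eqrXn2 _ 2)// ?mulr_ge0 ?enorm_ge0 ?modC_ge0//.
rewrite exprMn !sqr_enorm mulr_sumr; apply/eqP/eq_bigr => i _.
by rewrite mxE modCM exprMn.
Qed.

Lemma dotmx_sym0 (R : realType) (n : nat) (u v : 'CV[R]_n) :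
  dotmx u v = 0 -> dotmx v u = 0.
Proof. by move=> uv; rewrite hermC /= expr0 mul1r uv rmorph0. Qed.

Lemma sqr_enormD (R : realType) (n : nat) (u v : 'CV[R]_n) :
  dotmx u v = 0 -> enorm (u + v) ^+ 2 = enorm u ^+ 2 + enorm v ^+ 2.
Proof.
move=> uv; apply: (@complexI R); rewrite rmorphD.
have := @dnormD _ _ (@dotmx R[i] n) u v; rewrite /= uv conjC0 !addr0 => H.
by rewrite !(enorm_dotmx u, enorm_dotmx v, enorm_dotmx (u + v)); exact: H.
Qed.

Lemma modC_le_enorm (R : realType) (n : nat) (v : 'CV[R]_n) i : modC (v 0 i) <= enorm v.
Proof.
rewrite -ler_sqr ?nnegrE ?modC_ge0 ?enorm_ge0// sqr_enorm (bigD1 i)//= lerDl.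
by rewrite sumr_ge0// => j _; rewrite sqr_ge0.
Qed.

(* A real functional bounded by the distance from the origin divided by
   enorm p is stationary at p along the directions orthogonal to p. *)
Lemma support_orthogonal (R : realType) (n : nat) (g : 'CV[R]_n -> R)
    (c : 'M[Cx R]_(n, 1)) (p v : 'CV[R]_n) :
  (forall x, complex.Re ((x *m c) 0 0) <= g x) -> 1 <= complex.Re ((p *m c) 0 0) ->
  0 < enorm p -> dotmx v p = 0 ->
  (forall t : R[i], enorm p * g (p + t *: v) <= enorm (p + t *: v)) ->
  (v *m c) 0 0 = 0.
Proof.
move=> cg cp p0 vp gv; set d := (v *m c) 0 0.
apply/eqP; rewrite -modC_eq0; apply/negPn/negP => d0.
pose a := modC d ^+ 2; have a0 : 0 < a by rewrite exprn_gt0// lt0r d0 modC_ge0.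
pose B := enorm v ^+ 2 / enorm p ^+ 2.
have B0 : 0 <= B by rewrite divr_ge0// sqr_ge0.
pose s := (B + 1)^-1; have s0 : 0 < s by rewrite invr_gt0; lra.
have sB : s * B < 1 by rewrite /s mulrC ltr_pdivrMr ?mul1r ?ltrDl//; lra.
(* Moving by t v raises the functional by s |d|^2, to first order in s, but the squared norm only to
   second order. The choice of [s] makes s B < 1, so that the first-order gain wins. *)
pose t : R[i] := s%:C%C * conjc d.
have E1 : 1 + s * a <= g (p + t *: v).
  apply: le_trans (cg _); rewrite mulmxDl mxE raddfD /=; apply: lerD => //.
  rewrite -scalemxAl mxE -/d /t -mulrA /a sqr_modC.
  by case: (d) => x y; rewrite /= !mul0r subr0; rewrite le_eqVlt; apply/orP; left; apply/eqP; ring.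
have sa : 0 < s * a by rewrite mulr_gt0.
have E2 := gv t.
have {}E2 : enorm p * (1 + s * a) <= enorm (p + t *: v).
  by apply: le_trans E2; rewrite ler_pM2l.
have : (enorm p * (1 + s * a)) ^+ 2 <= enorm (p + t *: v) ^+ 2.
  rewrite ler_sqr ?E2// nnegrE ?enorm_ge0//; apply: mulr_ge0; first exact: enorm_ge0.
  by lra.
rewrite sqr_enormD; last by rewrite linearZr_LR /= (dotmx_sym0 vp) mulr0.
rewrite enormZ modCM modC_real (gtr0_norm s0).
have -> : modC (conjc d) = modC d.
  by rewrite /modC; case: (d) => x y /=; rewrite sqrrN.
rewrite !exprMn -/a.
have -> : enorm v ^+ 2 = B * enorm p ^+ 2 by rewrite /B divfK// expf_neq0// gt_eqF.
have -> : enorm p ^+ 2 + s ^+ 2 * a * (B * enorm p ^+ 2)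
  = enorm p ^+ 2 * (1 + s * a * (s * B)) by ring.
rewrite ler_pM2l ?exprn_gt0//.
have : s * a * (s * B) < s * a * 1 by rewrite ltr_pM2l.
have : 0 <= (s * a) ^+ 2 by rewrite sqr_ge0.
have -> : (1 + s * a) ^+ 2 = 1 + 2 * (s * a) + (s * a) ^+ 2 by ring.
by lra.
Qed.

Lemma orth_flagP (R : realType) (n : nat) (z : 'CV[R]_n) (p : nat -> 'CV[R]_n) j w :
  orth_flag z p j w <->
  (forall k, (1 <= k <= j)%N -> dotmx (w - z) (p k - z) = 0).
Proof.
elim: j => [|j IH] /=; first by split => // _ [|k].
rewrite IH; split=> [[H1 H2] k /andP[k1]|H].
  by rewrite leq_eqVlt => /predU1P[->//|kj]; apply: H1; rewrite k1.
by split=> [k /andP[k1 kj]|]; apply: H; rewrite ?leqnn// k1 (leq_trans kj).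
Qed.

Section flag.
Variables (R : realType) (n : nat) (D : set 'CV[R]_n) (z : 'CV[R]_n).
Variable p : nat -> 'CV[R]_n.
Hypotheses (oD : open D) (cD : is_convex D) (Dz : D z) (hp : minimal_points D z p).

Local Notation g := (gauge D z).

Definition flag_mx : 'M[Cx R]_n := \matrix_(i < n) (p i.+1 - z).

Let row_flag (i : 'I_n) : row i flag_mx = p i.+1 - z.
Proof. exact: rowK. Qed.

Lemma flag_orthogonal j k : (1 <= j <= n)%N -> (1 <= k <= n)%N -> j != k ->
  dotmx (p j - z) (p k - z) = 0.
Proof.
suff H (a b : nat) : (1 <= a <= n)%N -> (1 <= b)%N -> (b < a)%N ->
    dotmx (p a - z) (p b - z) = 0.
  move=> jn kn; rewrite neq_ltn => /orP[jk|kj].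
    by apply: dotmx_sym0; apply: H => //; case/andP: jn.
  by apply: H => //; case/andP: kn.
move=> an b1 ba; have [[_ /orth_flagP H] _] := hp an.
by apply: H; rewrite b1 -ltnS prednK//; case/andP: an.
Qed.

(** In terms of gauges, D contains the ball of radius tau_j of H_{j-1}: if g v > 0, then z + v / g v
    is a boundary point in H_{j-1}, so its distance from [z] is at least tau_j. *)
Lemma flag_gauge j v : (1 <= j <= n)%N ->
  (forall k, (1 <= k < j)%N -> dotmx v (p k - z) = 0) ->
  enorm (p j - z) * g v <= enorm v.
Proof.
move=> jn vk; have := gauge_ge0 oD Dz v; rewrite le_eqVlt => /predU1P[<-|g0].
  by rewrite mulr0 enorm_ge0.
have [_ /(_ (z + (g v)^-1%:C%C *: v))] := hp jn.
rewrite addrAC subrr add0r enormZ modC_real gtr0_norm ?invr_gt0// => H.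
rewrite -ler_pdivlMr// mulrC; apply: H; split; first exact: gauge_bdry.
apply/orth_flagP => k; rewrite addrAC subrr add0r => /andP[k1 kj].
rewrite linearZl_LR /= vk ?mulr0// k1/= (leq_ltn_trans kj)// prednK//.
by case/andP: jn.
Qed.

Lemma flag_enorm_gt0 j : (1 <= j <= n)%N -> 0 < enorm (p j - z).
Proof.
move=> jn; rewrite lt0r enorm_ge0 andbT; apply/negP => /eqP e0.
have [[[_ H] _] _] := hp jn; apply: H.
suff -> : p j = z by move/interior_id: oD => ->.
apply/eqP; rewrite -subr_eq0; apply/eqP/rowP => i; rewrite [RHS]mxE.
by apply/eqP; rewrite -modC_eq0 eq_le modC_ge0 andbT -[leRHS]e0 modC_le_enorm.
Qed.

Lemma flag_disc j (t : R[i]) : (1 <= j <= n)%N -> modC t < 1 -> D (z + t *: (p j - z)).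
Proof.
move=> jn t1; apply/(gauge_lt1 oD cD Dz); apply: le_lt_trans t1.
have e0 := flag_enorm_gt0 jn.
rewrite -(ler_pM2l e0) [leRHS]mulrC -enormZ; apply: flag_gauge => // k /andP[k1 kj].
rewrite linearZl_LR /= flag_orthogonal ?mulr0//; last by rewrite gtn_eqF.
by rewrite k1 (leq_trans (ltnW kj))//; case/andP: jn.
Qed.

(** The l^1 condition describes the absolutely convex hull of the discs spanned by the p^j - z. Each
    disc bounds the gauge of one term by the modulus of its coefficient, and sublinearity adds these
    bounds. *)
Lemma flag_polydisc (w : 'CV[R]_n) :
  \sum_i modC (w 0 i) < 1 -> D (z + w *m flag_mx).
Proof.
have [gD gZ] := gauge_sublinear oD cD Dz.
have g1 (t : R[i]) (i : 'I_n) : g (t *: (p i.+1 - z)) <= modC t.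
  have jn : (1 <= i.+1 <= n)%N by rewrite ltn_ord.
  have e0 := flag_enorm_gt0 jn.
  rewrite -(ler_pM2l e0) [leRHS]mulrC -enormZ; apply: flag_gauge => // k /andP[k1 kj].
  rewrite linearZl_LR /= flag_orthogonal ?mulr0//; last by rewrite gtn_eqF.
  by rewrite k1 (leq_trans (ltnW kj))//.
move=> w1; apply/(gauge_lt1 oD cD Dz); apply: le_lt_trans w1.
rewrite mulmx_sum_row.
elim/big_ind2: _ => [|x a y b xa yb|i _]; last by rewrite row_flag.
  by rewrite (sublinear0 (gauge_sublinear oD cD Dz)).
exact: le_trans (gD _ _) (lerD xa yb).
Qed.

Lemma tau_prod_gt0 : 0 < tau_prod z p.
Proof.
rewrite /tau_prod big_nat; apply: prodr_gt0 => j; rewrite ltnS; exact: flag_enorm_gt0.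
Qed.

(** The rows are orthogonal, so the Gram matrix P P^* is diagonal; its determinant is |det P|^2. *)
Lemma modC_det_flag : modC (\det flag_mx) = tau_prod z p.
Proof.
have PP : flag_mx *m (flag_mx^t*)%sesqui =
    diag_mx (\row_i (enorm (p i.+1 - z) ^+ 2)%:C%C).
  apply/matrixP => i j.
  have -> : (flag_mx *m (flag_mx ^t*)%sesqui) i j = dotmx (p i.+1 - z) (p j.+1 - z).
    rewrite dotmxE !mxE; apply: eq_bigr => k _.
    by rewrite -row_flag -(row_flag j) !mxE.
  rewrite [RHS]mxE mxE; have [->|ij] := eqVneq i j; first by rewrite mulr1n enorm_dotmx.
  by rewrite flag_orthogonal ?mulr0n ?ltn_ord// eqSS.
have := congr1 determinant PP.
rewrite det_mulmx det_map_mx det_tr det_diag.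
under eq_bigr do rewrite mxE.
rewrite -[_ * _]sqr_normc normcE -rmorphXn -rmorph_prod => /complexI E.
apply/eqP; rewrite -(@eqrXn2 _ 2)// ?modC_ge0 ?(ltW tau_prod_gt0)// E.
by rewrite /tau_prod big_add1 big_mkord /= prodrXl.
Qed.

(** Column j of [L] is the complexified supporting functional at p^{j+1}. The product with [flag_mx]
    is triangular with diagonal entries of real part at least 1, whence the bound on the
    determinant. *)
Lemma flag_functionals : exists L : 'M[Cx R]_n,
  (forall w j, D w -> complex.Re (((w - z) *m L) 0 j) < 1) /\
  1 <= modC (\det (flag_mx *m L)).
Proof.
have H (j : 'I_n) : exists c : 'M[Cx R]_(n, 1),
    [/\ forall x, complex.Re ((x *m c) 0 0) <= g x,
      1 <= complex.Re (((p j.+1 - z) *m c) 0 0) &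
      forall k : 'I_n, (j < k)%N -> ((p k.+1 - z) *m c) 0 0 = 0].
  have jn : (1 <= j.+1 <= n)%N by rewrite ltn_ord.
  have [c [cg cp]] := sublinear_support (p j.+1 - z) (gauge_sublinear oD cD Dz).
  have cp1 : 1 <= complex.Re (((p j.+1 - z) *m c) 0 0).
    by rewrite cp; have [[b _] _] := hp jn; exact: bdry_gauge.
  exists c; split => // k jk.
  (* For k > j, adding a multiple of p^{k+1} - z to p^{j+1} - z stays orthogonal to the earlier
     points p^l - z, l <= j, so [flag_gauge] applies along the whole perturbation. *)
  apply: (support_orthogonal cg cp1 (flag_enorm_gt0 jn)).
    by apply: flag_orthogonal; rewrite ?ltn_ord// eqSS gtn_eqF.
  move=> t; apply: flag_gauge => // l /andP[l1 lj].
  have ln : (1 <= l <= n)%N by rewrite l1 (leq_trans (ltnW lj)).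
  rewrite linearDl /= linearZl_LR /= !flag_orthogonal ?mulr0 ?addr0 ?ltn_ord//.
    by rewrite gtn_eqF// (ltn_trans lj).
  by rewrite gtn_eqF.
have [c Hc] := choice H.
pose L : 'M[Cx R]_n := \matrix_(i, j) c j i 0.
have LE x j : (x *m L) 0 j = (x *m c j) 0 0 :> R[i].
  by rewrite !mxE; apply: eq_bigr => i _; rewrite mxE.
exists L; split.
  move=> w j Dw; rewrite LE; have [cg _ _] := Hc j; apply: le_lt_trans (cg _) _.
  by apply/(gauge_lt1 oD cD Dz); rewrite addrC subrK.
have PLE i j : (flag_mx *m L) i j = ((p i.+1 - z) *m c j) 0 0.
  by rewrite -LE -row_flag -row_mul [RHS]mxE.
rewrite -det_tr det_trig; last first.
  by apply/is_trig_mxP => i j ij; rewrite mxE PLE; have [_ _] := Hc i; exact.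
rewrite (big_morph _ (@modCM R) (@modC1 R)).
apply: (@le_trans _ _ (\prod_(i < n) (1 : R))); first by rewrite big1_eq.
apply: ler_prod => j _; rewrite ler01 mxE PLE; have [_ cp _] := Hc j.
by apply: le_trans (Re_le_modC _); apply: le_trans (ler_norm _).
Qed.

End flag.

(** * Determinants, jacobians and half-planes *)

Lemma modC_nat (R : realType) (n : nat) : modC (n%:R : R[i]) = n%:R.
Proof. by rewrite -(rmorph_nat (real_complex R)) modC_real normr_nat. Qed.

Lemma ler_modC_sum (R : realType) (I : Type) (r : seq I) (P : pred I) (F : I -> R[i]) :
  modC (\sum_(i <- r | P i) F i) <= \sum_(i <- r | P i) modC (F i).
Proof.
elim/big_ind2: _ => [|x a y b xa yb|//]; first by rewrite modC0.
by apply: le_trans (ler_modCD _ _) (lerD xa yb).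
Qed.

(** Expanding the product of row sums gives one nonnegative term for each map f of the indices;
    those with f injective are the moduli of the terms of the Leibniz formula. *)
Lemma modC_det_le (R : realType) (n : nat) (A : 'M[Cx R]_n) :
  modC (\det A) <= \prod_i \sum_j modC (A i j).
Proof.
rewrite bigA_distr_bigA /=; apply: le_trans (ler_modC_sum _ _ _) _.
rewrite [leRHS](bigID (fun f : {ffun 'I_n -> 'I_n} => injectiveb f)) /=.
rewrite [X in _ <= X + _](reindex (@pval _)) /=; last first.
  pose in_Sn := insubd (1%g : 'S_n).
  by exists in_Sn => /= f Uf; first apply: val_inj; apply: insubdK.
rewrite -[leLHS]addr0; apply: lerD; last first.
  by rewrite sumr_ge0// => f _; rewrite prodr_ge0// => i _; exact: modC_ge0.
rewrite le_eqVlt; apply/orP; left; apply/eqP; apply: eq_big => /= [s|s _].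
  by rewrite (valP s).
rewrite modCM (_ : modC (_ ^+ _) = 1) ?mul1r.
  rewrite (big_morph _ (@modCM R) (@modC1 R)); apply: eq_bigr => i _.
  by rewrite -pvalE.
by case: (s : bool); rewrite ?expr0 ?expr1 ?modCN modC1.
Qed.

Lemma is_derive_cvg (K : numFieldType) (V W : normedModType K) (f : V -> W) a v l :
  (fun h => h^-1 *: (f (h *: v + a) - f a)) @ 0^' --> l -> is_derive a v f l.
Proof.
move=> fl; split; first by apply/cvg_ex; exists l.
by apply: cvg_lim => //; exact: norm_hausdorff.
Qed.

Section lines.
Variables (R : realType) (n m : nat) (f : 'CV[R]_n -> 'CV[R]_m).
Implicit Types a v : 'CV[R]_n.

Lemma is_derive_line a v j : differentiable f a ->
  is_derive (0 : Cx R) 1 (fun t : Cx R => f (a + t *: v) 0 j : Cx R)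
    ((v *m jacobian f a) 0 j).
Proof.
move=> fa; apply: is_derive_cvg; rewrite -deriveEjacobian//.
have D : h^-1 *: (f (h *: v + a) - f a) @[h --> (0 : Cx R)^'] --> 'D_v f a.
  exact: (diff_derivable fa).
have H := cvg_comp _ _ D (@coord_continuous _ _ _ 0 j _).
apply: cvg_trans H; apply: near_eq_cvg; apply: nearW => h.
by rewrite /= !mxE scale0r addr0 /GRing.scale /= mulr1 addr0 (addrC a).
Qed.

Lemma differentiable_line a v j (t : Cx R) : differentiable f (a + t *: v) ->
  differentiable (fun t : Cx R => f (a + t *: v) 0 j : Cx R) t.
Proof.
move=> fa.
apply: (@differentiable_comp _ _ _ _ (fun t : Cx R => f (a + t *: v))
  (fun x : 'CV[R]_m => x 0 j : Cx R)); last exact: differentiable_coord.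
apply: (@differentiable_comp _ _ _ _ (fun t : Cx R => a + t *: v) f) => //.
Qed.

Lemma jacobian_eq a (A : 'M[Cx R]_(n, m)) : differentiable f a ->
  (forall i j, is_derive (0 : Cx R) 1
    (fun t : Cx R => f (a + t *: delta_mx 0 i) 0 j : Cx R) (A i j)) ->
  jacobian f a = A.
Proof.
move=> fa fA; apply/matrixP => i j.
have [_ <-] := fA i j; have [_ ->] := is_derive_line (delta_mx 0 i) j fa.
by rewrite -rowE [RHS]mxE.
Qed.

End lines.

Lemma differentiable_mulmx (R : realType) (n m : nat) (M : 'M[Cx R]_(n, m)) (a : 'CV[R]_n) :
  differentiable (fun x : 'CV[R]_n => x *m M : 'CV[R]_m) a.
Proof.
have -> : (fun x : 'CV[R]_n => x *m M : 'CV[R]_m) =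
    \sum_(i < n) (fun x : 'CV[R]_n => x 0 i *: row i M).
  by apply/funext => x; rewrite mulmx_sum_row fct_sumE.
apply: differentiable_sum => i; apply: differentiableZl.
exact: differentiable_coord.
Qed.

Section halfplane.
Variable R : realType.
Implicit Types u : Cx R.

Lemma halfplane_neq0 u : complex.Re u < 1 -> 2 - u != 0.
Proof.
case: u => a b /= a1; apply/negP => /eqP/(congr1 (@complex.Re R)).
by rewrite /= => E; move: E; rewrite -[1 + 1]/(2 : R) => E; lra.
Qed.

(* u / (2 - u) maps the half-plane Re u < 1 onto the unit disc. *)
Lemma halfplane_disc u : complex.Re u < 1 -> modC (u / (2 - u)) < 1.
Proof.
move=> u1; have u0 := halfplane_neq0 u1.
have m0 : 0 < modC (2 - u) by rewrite lt0r modC_ge0 modC_eq0 u0.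
rewrite modCM modCV ltr_pdivrMr// mul1r -ltr_sqr ?nnegrE ?modC_ge0// !sqr_modC.
case: u u1 {u0 m0} => a b /= a1.
by rewrite -subr_gt0 (_ : _ - _ = 4 * (1 - a)); [lra|ring].
Qed.

Lemma differentiable_halfplane (V : normedModType (Cx R)) (g : V -> Cx R) x :
  differentiable g x -> complex.Re (g x) < 1 ->
  differentiable (fun t => g t / (2 - g t)) x.
Proof.
move=> gx g1; apply: differentiableM; first exact: gx.
apply: differentiableV; last exact: halfplane_neq0.
exact: (differentiableB (@differentiable_cst _ _ (Cx R) 2 x) gx).
Qed.

Lemma is_derive_halfplane (g : Cx R -> Cx R) l : is_derive (0 : Cx R) 1 g l -> g 0 = 0 ->
  is_derive (0 : Cx R) 1 (fun t => g t / (2 - g t)) (l / 2).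
Proof.
move=> [gd gl] g0.
have n0 : 2 - g 0 != 0 by rewrite g0 subr0 pnatr_eq0.
have /derivable1_diffP gd' := gd.
have hd : derivable (fun t => 2 - g t) (0 : Cx R) 1.
  by apply/derivable1_diffP; exact: (differentiableB (@differentiable_cst _ _ (Cx R) 2 0) gd').
have hvd := @derivableV _ _ (fun t => 2 - g t) (0 : Cx R) 1 n0 hd.
have -> : (fun t => g t / (2 - g t)) = g * (fun t => (2 - g t)^-1) by [].
split; first exact: (derivableM gd hvd).
rewrite (deriveM gd hvd) gl g0 scale0r add0r subr0.
by rewrite /GRing.scale /= mulrC.
Qed.

(** The map u |-> u / (2 - u) into the disc has derivative 1/2 at 0, so the Schwarz lemma bounds l /
    2 by 1. *)
Lemma halfplane_schwarz (g : Cx R -> Cx R) l :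
  (forall x : Cx R, modC x < 1 -> differentiable g x /\ complex.Re (g x) < 1) ->
  g 0 = 0 -> is_derive (0 : Cx R) 1 g l -> modC l <= 2.
Proof.
move=> gd g0 gl; have [_ E] := is_derive_halfplane gl g0.
have : modC (l / 2) <= 1.
  rewrite -E; apply: schwarz_derive => [x x1|x x1|]; last by rewrite g0 mul0r.
    by have [? ?] := gd x x1; exact: differentiable_halfplane.
  by have [_ ?] := gd x x1; rewrite ltW// halfplane_disc.
rewrite modCM modCV (modC_nat R 2).
by rewrite ler_pdivrMr// mul1r.
Qed.

End halfplane.

(** * The four estimates *)

Section volume_elements.
Variables (R : realType) (n : nat) (D : set 'CV[R]_n) (z : 'CV[R]_n).
Variable p : nat -> 'CV[R]_n.
Hypotheses (n0 : (0 < n)%N) (oD : open D) (cD : is_convex D) (Dz : D z).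
Hypothesis hp : minimal_points D z p.

Local Notation T := (tau_prod z p).
Local Notation P := (flag_mx z p).

Let q : R := Num.sqrt n%:R.

Let q0 : 0 < q.
Proof. by rewrite sqrtr_gt0 ltr0n. Qed.

Let qq : q ^+ 2 = n%:R.
Proof. by rewrite sqr_sqrtr// ler0n. Qed.

Let T0 : 0 < T.
Proof. exact: (tau_prod_gt0 oD Dz hp). Qed.

(** It puts the unit ball into the l^1 ball of radius sqrt n; this is why the competitor for k_D is
    scaled by 1 / sqrt n. *)
Lemma sum_modC_lt (w : 'CV[R]_n) : enorm w < 1 -> \sum_i modC (w 0 i) < q.
Proof.
move=> w1.
(* AM-GM termwise: 2 a <= q a^2 + 1 / q *)
have H (i : 'I_n) : modC (w 0 i) <= (q * modC (w 0 i) ^+ 2 + q^-1) / 2.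
  move: (modC _) => a.
  have : 0 <= (q * a - 1) ^+ 2 / q by rewrite divr_ge0 ?sqr_ge0// ltW.
  rewrite (_ : _ / q = q * a ^+ 2 + q^-1 - 2 * a); first by lra.
  by field; rewrite gt_eqF.
apply: le_lt_trans (ler_sum _ (fun i _ => H i)) _.
rewrite -mulr_suml big_split /= -mulr_sumr -sqr_enorm sumr_const card_ord.
rewrite -[q^-1 *+ n]mulr_natl -qq expr2 mulfK ?gt_eqF// -[X in _ + X]mulr1 -mulrDr.
rewrite -mulrA -[ltRHS]mulr1 ltr_pM2l// ltr_pdivrMr// mul1r.
have : enorm w ^+ 2 < 1 by rewrite expr_lt1// ?enorm_ge0.
by lra.
Qed.

(** The affine competitor w |-> z + w P / sqrt n has Jacobian of modulus n^(-n/2) T, whose inverse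
    square is the bound. *)
Lemma kobayashi_upper : (kobayashi_vol D z <= ((n%:R ^+ n) / T ^+ 2)%:E)%E.
Proof.
pose A : 'M[Cx R]_n := (q^-1)%:C%C *: P.
pose f (w : 'CV[R]_n) : 'CV[R]_n := z + w *m A.
have fd w : differentiable f w.
  exact: (differentiableD (@differentiable_cst _ _ _ z w) (differentiable_mulmx A w)).
have Jf : jacobian f 0 = A.
  apply: jacobian_eq => // i j; apply/is_derive_modCP => e e0; exists 1 => // h _.
  suff -> : f (0 + (0 + h) *: delta_mx 0 i) 0 j - f (0 + 0 *: delta_mx 0 i) 0 j
      - A i j * h = 0 by rewrite modC0 mulr_ge0 ?modC_ge0// ltW.
  rewrite /f !add0r scale0r mul0mx addr0 -scalemxAl -rowE.
  by rewrite !mxE; ring.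
have jf : jac_mod f 0 = q ^- n * T.
  rewrite /jac_mod Jf detZ modCM (modC_det_flag oD Dz hp); congr (_ * _).
  rewrite -rmorphXn modC_real normrX gtr0_norm ?invr_gt0// exprVn//.
have j0 : 0 < jac_mod f 0 by rewrite jf mulr_gt0// invr_gt0 exprn_gt0.
apply: ereal_inf_lbound; exists f; last first.
  rewrite gt_eqF//; congr (_%:E).
  by rewrite jf exprMn exprVn invfM invrK -exprM mulnC exprM qq.
split; last by rewrite /f mul0mx addr0.
split=> w; first by move=> _; exact: fd.
move=> w1; rewrite /f /A -scalemxAr scalemxAl; apply: (flag_polydisc oD cD Dz hp).
under eq_bigr do rewrite mxE modCM modC_real gtr0_norm ?invr_gt0//.
by rewrite -mulr_sumr mulrC ltr_pdivrMr// mul1r; exact: sum_modC_lt.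
Qed.

(** The entries of P f'(z) are at most 1 in modulus, so each row sum is at most n and T |det f'(z)|
    <= n^n. *)
Lemma caratheodory_upper : (caratheodory_vol D z <= ((n%:R ^+ 2) ^+ n / T ^+ 2)%:E)%E.
Proof.
apply: ge_ereal_sup => _ [f [[fd fB] fz] <-]; rewrite lee_fin.
have PJ i j : modC ((P *m jacobian f z) i j) <= 1.
  have [_ E] := is_derive_line (p i.+1 - z) j (fd z Dz).
  have -> : (P *m jacobian f z) i j = ((p i.+1 - z) *m jacobian f z) 0 j.
    by rewrite -(rowK (fun i : 'I_n => p i.+1 - z)) -row_mul [RHS]mxE.
  have iD (x : Cx R) : modC x < 1 -> D (z + x *: (p i.+1 - z)).
    by move=> x1; apply: (flag_disc oD cD Dz hp); rewrite ?ltn_ord.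
  rewrite -E; apply: schwarz_derive => [x x1|x x1|].
  - by apply: differentiable_line; apply/fd/iD.
  - by apply: le_trans (modC_le_enorm _ _) _; apply/ltW/fB/iD.
  - by rewrite scale0r addr0 fz mxE.
have : T * jac_mod f z <= n%:R ^+ n.
  rewrite -(modC_det_flag oD Dz hp) -modCM -det_mulmx.
  apply: le_trans (modC_det_le _) _.
  apply: (@le_trans _ _ (\prod_(i < n) n%:R)); last by rewrite prodr_const card_ord.
  apply: ler_prod => i _; rewrite sumr_ge0 => [|j _]; last exact: modC_ge0.
  by apply: le_trans (ler_sum _ (fun j _ => PJ i j)) _; rewrite sumr_const card_ord.
rewrite ler_pdivlMr ?exprn_gt0// mulrC -exprMn exprAC => H.
by rewrite ler_sqr// ?nnegrE ?exprn_ge0// mulr_ge0 ?modC_ge0// ltW.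
Qed.

(** The half-plane map contributes a factor 1/2 and the scaling a factor 1 / sqrt n in each
    coordinate, so the competitor has Jacobian (2 sqrt n)^-n |det L|, where T |det L| >= 1. *)
Lemma caratheodory_lower : ((((4 * n%:R) ^+ n)^-1 / T ^+ 2)%:E <= caratheodory_vol D z)%E.
Proof.
have [L [LD detL]] := flag_functionals oD cD Dz hp.
pose u j (w : 'CV[R]_n) : Cx R := ((w - z) *m L) 0 j.
pose g j (w : 'CV[R]_n) : Cx R := (q^-1)%:C%C * (u j w / (2 - u j w)).
pose f (w : 'CV[R]_n) : 'CV[R]_n := \row_j g j w.
have ud j w : differentiable (u j) w.
  have wd : differentiable (fun w : 'CV[R]_n => w - z) w.
    exact: (differentiableB (ex_diff (f := @id 'CV[R]_n)) (@differentiable_cst _ _ _ z w)).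
  apply: (@differentiable_comp _ _ _ _ (fun w : 'CV[R]_n => (w - z) *m L)
    (fun x : 'CV[R]_n => x 0 j : Cx R)); last exact: differentiable_coord.
  exact: (@differentiable_comp _ _ _ _ _ (fun x : 'CV[R]_n => x *m L) w wd
    (differentiable_mulmx L _)).
have fd w : D w -> differentiable f w.
  move=> Dw; have -> : f = \sum_(j < n) (fun w => g j w *: delta_mx 0 j).
    apply/funext => x; rewrite fct_sumE (row_sum_delta (f x)).
    by apply: eq_bigr => j _; rewrite mxE.
  apply: differentiable_sum => j; apply: differentiableZl.
  apply: differentiableM; first exact: differentiable_cst.
  by apply: differentiable_halfplane => //; exact: LD.
have uz j : u j z = 0 by rewrite /u subrr mul0mx mxE.
have Jf : jacobian f z = (q^-1 / 2)%:C%C *: L.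
  apply: jacobian_eq => [|i j]; first exact: fd.
  have ul : is_derive (0 : Cx R) 1 (fun t => u j (z + t *: delta_mx 0 i)) (L i j).
    apply/is_derive_modCP => e e0; exists 1 => // h _.
    suff -> : u j (z + (0 + h) *: delta_mx 0 i) - u j (z + 0 *: delta_mx 0 i)
      - L i j * h = 0 by rewrite modC0 mulr_ge0 ?modC_ge0// ltW.
    rewrite add0r scale0r addr0 uz subr0 /u addrAC subrr add0r -scalemxAl -rowE.
    by rewrite !mxE mulrC subrr.
  have /is_derive_halfplane [] := ul; first by rewrite scale0r addr0.
  move=> hd hl.
  have -> : (fun t : Cx R => f (z + t *: delta_mx 0 i) 0 j : Cx R) = (fun t : Cx R =>
     (q^-1)%:C%C * (u j (z + t *: delta_mx 0 i) / (2 - u j (z + t *: delta_mx 0 i)))).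
    by apply/funext => t; rewrite mxE.
  split; first exact: (@derivableZ _ _ _ _ (q^-1)%:C%C _ _ hd).
  rewrite (@deriveZ _ _ _ _ (q^-1)%:C%C _ _ hd) hl mxE.
  have -> : (q^-1 / 2)%:C%C = (q^-1)%:C%C / 2 :> R[i].
    by rewrite rmorphM; congr (_ * _); rewrite fmorphV rmorph_nat.
  by rewrite /GRing.scale /= -mulrA [_^-1 * _]mulrC.
have jf : jac_mod f z = (2 * q) ^- n * modC (\det L).
  rewrite /jac_mod Jf detZ modCM; congr (_ * _).
  by rewrite -rmorphXn modC_real normrX gtr0_norm ?divr_gt0 ?invr_gt0// -exprVn invfM mulrC.
apply: (@le_trans _ _ (jac_mod f z ^+ 2)%:E); last first.
  apply: ereal_sup_ubound; exists f => //; split; last first.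
    by apply/rowP => j; rewrite !mxE /g uz mul0r mulr0.
  split=> [//|w Dw]; rewrite /unit_ball /= -(@ltr_sqr R) ?nnegrE ?enorm_ge0//.
  rewrite sqr_enorm expr1n; apply: (@lt_le_trans _ _ (\sum_(j < n) q ^- 2)).
    (* The sum of strict inequalities is strict only over a nonempty index set, hence the index 0 <
       n. *)
    apply: ltr_sum; first by apply/hasP; exists (Ordinal n0); rewrite ?mem_index_enum.
    move=> j _; rewrite mxE modCM exprMn modC_real gtr0_norm ?invr_gt0// exprVn.
    rewrite -[ltRHS]mulr1 ltr_pM2l ?invr_gt0 ?exprn_gt0// expr_lt1// ?modC_ge0//.
    by apply/halfplane_disc/LD.
  by rewrite sumr_const card_ord qq -[_ *+ _]mulr_natr mulVf// pnatr_eq0 -lt0n.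
move: detL; rewrite lee_fin det_mulmx modCM (modC_det_flag oD Dz hp) => detL.
have -> : jac_mod f z ^+ 2 = ((4 * n%:R) ^+ n)^-1 * modC (\det L) ^+ 2.
  by rewrite jf exprMn exprVn exprAC [(2 * q) ^+ 2]exprMn qq -natrX.
rewrite ler_pM2l ?invr_gt0 ?exprn_gt0 ?mulr_gt0 ?ltr0n//.
rewrite -div1r ler_pdivrMr ?exprn_gt0// mulrC -exprMn.
by rewrite -[leLHS](expr1n _ 2) ler_sqr ?nnegrE// mulr_ge0 ?modC_ge0// ltW.
Qed.

(** Column sums bounded by 2 sqrt n give |det f'(0)| |det L| <= (2 sqrt n)^n; with T |det L| >= 1
    this becomes |det f'(0)| <= (2 sqrt n)^n T, to be inverted and squared. *)
Lemma kobayashi_lower : ((((4 * n%:R) ^+ n)^-1 / T ^+ 2)%:E <= kobayashi_vol D z)%E.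
Proof.
have [L [LD detL]] := flag_functionals oD cD Dz hp.
apply: le_ereal_inf_tmp => _ [f [[fd fD] fz] <-].
case: eqVneq => [_|j0]; first exact: leey.
set J := jacobian f 0.
have B0 : unit_ball (0 : 'CV[R]_n).
  rewrite /unit_ball /= -(@ltr_sqr R) ?nnegrE ?enorm_ge0// sqr_enorm big1 ?expr1n// => i _.
  by rewrite mxE modC0 expr0n.
(* The function t |-> L_j (f (t v) - z) maps the unit disc into Re < 1 and vanishes at 0, so its
   derivative there is at most 2 in modulus. *)
have vJL (v : 'CV[R]_n) j : enorm v <= 1 -> modC ((v *m (J *m L)) 0 j) <= 2.
  move=> v1; pose g (t : Cx R) : Cx R := ((f (0 + t *: v) - z) *m L) 0 j.
  have vB (x : Cx R) : modC x < 1 -> unit_ball (0 + x *: v).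
    move=> x1; rewrite /unit_ball /= add0r enormZ.
    by apply: le_lt_trans x1; rewrite ler_piMr ?modC_ge0.
  have gE : g = \sum_(i < n)
      ((fun t : Cx R => f (0 + t *: v) 0 i : Cx R) - cst (z 0 i)) * cst (L i j).
    by apply/funext => t; rewrite fct_sumE /g mxE; apply: eq_bigr => i _; rewrite !mxE.
  apply: (@halfplane_schwarz _ g).
  - move=> x x1; split; last exact/LD/fD/vB.
    rewrite gE; apply: differentiable_sum => i.
    apply: differentiableM; last exact: differentiable_cst.
    apply: differentiableB; last exact: differentiable_cst.
    by apply: differentiable_line; exact/fd/vB.
  - by rewrite /g scale0r addr0 fz subrr mul0mx mxE.
  - have dl i : is_derive (0 : Cx R) 1 (((fun t : Cx R => f (0 + t *: v) 0 i : Cx R)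
        - cst (z 0 i)) * cst (L i j)) ((v *m J) 0 i * L i j).
      have H1 := is_deriveB (is_derive_line v i (fd _ B0)) (is_derive_cst (z 0 i) (0 : Cx R) 1).
      have H2 := is_deriveM H1 (is_derive_cst (L i j) (0 : Cx R) 1).
      by apply: is_derive_eq H2 _; rewrite scaler0 add0r subr0 /GRing.scale /= mulrC.
    rewrite gE; apply: is_derive_eq (is_derive_sum dl) _.
    by rewrite mulmxA mxE.
(* The vector v below has entries of modulus at most 1 / sqrt n, hence norm at most 1, and phases
   opposite to those of column j, so that v M turns the column into its l^1 norm divided by sqrt
   n. *)
have col j : \sum_i modC ((J *m L) i j) <= 2 * q.
  set M := J *m L.
  (* where M i j = 0 the phase below is 0 / 0 = 0 *)
  pose v : 'CV[R]_n := \row_i ((q^-1 * modC (M i j))%:C%C / M i j).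
  have v1 : enorm v <= 1.
    rewrite -ler_sqr ?nnegrE ?enorm_ge0// sqr_enorm expr1n.
    apply: (@le_trans _ _ (\sum_(i < n) q ^- 2)); last first.
      by rewrite sumr_const card_ord qq -[_ *+ _]mulr_natr mulVf// pnatr_eq0 -lt0n.
    apply: ler_sum => i _; rewrite mxE modCM modCV modC_real.
    rewrite ger0_norm ?mulr_ge0 ?invr_ge0 ?modC_ge0 ?(ltW q0)// -exprVn.
    rewrite -mulrA exprMn ler_piMr ?sqr_ge0//.
    have [->|m0] := eqVneq (modC (M i j)) 0; first by rewrite mul0r expr0n ler01.
    by rewrite divff// expr1n.
  have := vJL v j v1.
  have -> : (v *m M) 0 j = (q^-1 * \sum_i modC (M i j))%:C%C.
    rewrite mxE mulr_sumr rmorph_sum; apply: eq_bigr => i _; rewrite mxE.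
    have [E|m0] := eqVneq (M i j) 0; last by rewrite divfK.
    by rewrite E modC0 !mulr0 rmorph0.
  rewrite modC_real ger0_norm; last first.
    by rewrite mulr_ge0 ?invr_ge0 ?(ltW q0)// sumr_ge0// => i _; exact: modC_ge0.
  by rewrite mulrC ler_pdivrMr.
have : jac_mod f 0 * modC (\det L) <= (2 * q) ^+ n.
  (* The transpose turns the bounds on columns into the row bounds that [modC_det_le] needs. *)
  rewrite -modCM -det_mulmx -det_tr; apply: le_trans (modC_det_le _) _.
  apply: (@le_trans _ _ (\prod_(i < n) (2 * q))); last by rewrite prodr_const card_ord.
  apply: ler_prod => i _; rewrite sumr_ge0 => [|j _]; last exact: modC_ge0.
  by under eq_bigr do rewrite mxE; exact: col.
move: detL; rewrite lee_fin det_mulmx modCM (modC_det_flag oD Dz hp) => detL jl.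
have jp : 0 < jac_mod f 0 by rewrite lt0r j0 modC_ge0.
rewrite -invfM lef_pV2 ?posrE ?mulr_gt0 ?exprn_gt0 ?mulr_gt0 ?ltr0n//.
have -> : (4 * n%:R) ^+ n * T ^+ 2 = ((2 * q) ^+ n * T) ^+ 2.
  by rewrite [RHS]exprMn exprAC [(2 * q) ^+ 2]exprMn qq -natrX.
rewrite ler_sqr ?nnegrE ?modC_ge0//; last first.
  by rewrite mulr_ge0 ?exprn_ge0 ?mulr_ge0// ltW.
apply: (@le_trans _ _ (jac_mod f 0 * modC (\det L) * T)).
  by rewrite -mulrA [_ * T]mulrC ler_peMr// ltW.
by rewrite ler_pM2r.
Qed.

End volume_elements.

(** This is n^2 <= (4^n - 1) / 3 in integers; it carries the proved upper constants n^n and (n^2)^n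
    to the stated one. *)
Lemma sqr_le_pow4 (n : nat) : (2 <= n)%N -> (3 * n ^ 2 + 1 <= 4 ^ n)%N.
Proof.
elim: n => // n IH; rewrite ltnS leq_eqVlt => /predU1P[<-//|/IH {}IH].
rewrite [(4 ^ n.+1)%N]expnS; move: (4 ^ n)%N IH => k; rewrite -!mulnn.
have : (n <= n * n)%N by case: (n) => // m; rewrite leq_pmulr.
rewrite mulSn mulnS; lia.
Qed.

Theorem theorem1p1 (R : realType) (n : nat) (hn : (2 <= n)%N)
    (D : set 'CV[R]_n) (domD : is_domain D) (convD : is_convex D)
    (ndegD : non_degenerate D) (z : 'CV[R]_n) (Dz : D z)
    (p : nat -> 'CV[R]_n) (hp : minimal_points D z p) :
  let lower : R := ((4 * n%:R) ^+ n)^-1 in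
  let upper : R := ((4 ^+ n - 1) / 3) ^+ n in
  (lower%:E <= caratheodory_vol D z * (tau_prod z p ^+ 2)%:E <= upper%:E)%E /\
  (lower%:E <= kobayashi_vol D z * (tau_prod z p ^+ 2)%:E <= upper%:E)%E.
Proof.
move=> lower upper; have [_ oD _] := domD.
have n0 : (0 < n)%N by apply: leq_trans hn.
have T0 := tau_prod_gt0 oD Dz hp.
have T2 : 0 < tau_prod z p ^+ 2 by rewrite exprn_gt0.
have n2 : n%:R ^+ 2 <= (4 ^+ n - 1) / 3 :> R.
  rewrite ler_pdivlMr// lerBrDr mulrC -!natrX -[3]/(3%:R) -natrM -[1]/(1%:R) -natrD ler_nat.
  exact: sqr_le_pow4.
have nn : (n%:R ^+ 2) ^+ n <= upper.
  apply: lerXn2r => //; rewrite nnegrE; first exact: sqr_ge0.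
  exact: le_trans (sqr_ge0 _) n2.
have nu : n%:R ^+ n <= upper.
  apply: le_trans nn; rewrite lerXn2r ?nnegrE ?sqr_ge0//.
  by rewrite ler_eXnr// ler1n.
have upE (x : \bar R) (a : R) : a <= upper -> (x <= (a / tau_prod z p ^+ 2)%:E)%E ->
    (x * (tau_prod z p ^+ 2)%:E <= upper%:E)%E.
  move=> au; rewrite EFinM lee_pdivlMr// => xa.
  by apply: (le_trans xa); rewrite lee_fin.
have loE (x : \bar R) : ((lower / tau_prod z p ^+ 2)%:E <= x)%E ->
    (lower%:E <= x * (tau_prod z p ^+ 2)%:E)%E.
  by rewrite EFinM lee_pdivrMr.
split; apply/andP; split.
- exact/loE/caratheodory_lower.
- exact: upE nn (caratheodory_upper oD convD Dz hp).
- exact/loE/kobayashi_lower.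
- exact: upE nu (kobayashi_upper n0 oD convD Dz hp).
Qed.
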